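(* The global Witt ring $\mathbb{W}_0(\mathbb{S})$ is canonically isomorphic, as a ring, to the invariant part $\mathbb{Z}[\mathbb{Q}/\mathbb{Z}]^G$ of the group ring $\mathbb{Z}[\mathbb{Q}/\mathbb{Z}]$ under the action of the group $G=\mathrm{Aut}(\mathbb{Q}/\mathbb{Z})=\widehat{\mathbb{Z}}^\times$.
   Context: $\Gamma^{\mathrm{op}}$ is the category with objects the pointed sets $k_+=\{0,1,\dots,k\}$ ($k\ge 0$, base point $0$) and morphisms the base-point preserving maps. An $\mathbb{S}$-module is a pointed covariant functor from $\Gamma^{\mathrm{op}}$ to pointed sets; morphisms of $\mathbb{S}$-modules are natural transformations. $\mathbb{S}$ is the inclusion functor. $\mathbb{S}$-modules form a closed symmetric monoidal category with unit $\mathbb{S}$ for the (Day/Lydakis) smash product $\wedge$. For a finite pointed set $F$, $\mathbb{S}\wedge F$ is the $\mathbb{S}$-module $k_+\mapsto k_+\wedge F$; one has $(\mathbb{S}\wedge F_1)\wedge(\mathbb{S}\wedge F_2)=\mathbb{S}\wedge(F_1\wedge F_2)$. The wedge (join) of $\mathbb{S}$-modules is $(E_1\vee E_2)(k_+)=E_1(k_+)\vee E_2(k_+)$. Let $\mathcal{C}$ be the class of $\mathbb{S}$-modules (isomorphic to one) of the form $\mathbb{S}\wedge F$, with $F$ a finite pointed set, and let $\mathrm{End}(\mathcal{C})$ be the class of pairs $(E,T)$ with $E\in\mathcal{C}$ and $T:E\to E$ an endomorphism of $\mathbb{S}$-modules. $T(E)\subset E$ denotes the image $\mathbb{S}$-submodule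 $k_+\mapsto T(E(k_+))$, on which $T$ acts by restriction. An additive invariant on $\mathcal{C}$ is a map $\chi:\mathrm{End}(\mathcal{C})\to A$ to an abelian group $A$ (depending only on the isomorphism class of the pair $(E,T)$) such that (i) $\chi(E,T)=\chi(T(E),T)$; (ii) $\chi(E_1\vee E_2,T_1\vee T_2)=\chi(E_1,T_1)+\chi(E_2,T_2)$. $\mathbb{W}_0(\mathbb{S})$ is the abelian group which is the target of the universal additive invariant on $\mathcal{C}$ (every additive invariant factors uniquely through it by a group homomorphism). It is a commutative ring with product induced by $(E_1,T_1)\wedge(E_2,T_2):=(E_1\wedge E_2,T_1\wedge T_2)$. $\mathrm{Aut}(\mathbb{Q}/\mathbb{Z})$ is the group of automorphisms of the abelian group $\mathbb{Q}/\mathbb{Z}$, acting on $\mathbb{Z}[\mathbb{Q}/\mathbb{Z}]$ by ring automorphisms. *)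

(* Defs.v *)
From HB Require Import structures.
From Stdlib Require Import Relation_Operators.
From mathcomp Require Import all_boot all_order all_algebra.
From mathcomp Require Import boolp classical_sets functions cardinality.
From mathcomp Require Import finmap monalg.

Set Implicit Arguments.
Unset Strict Implicit.
Unset Printing Implicit Defensive.

Import GRing.Theory.

Record pset := PSet { pset_sort :> Type; base : pset_sort }.
Arguments base {p}.

Record pmap (X Y : pset) := PMap { pmap_fun :> X -> Y; pmapP : pmap_fun base = base }.

Lemma pmap_eq (X Y : pset) (f g : pmap X Y) : f =1 g -> f = g.
Proof.
case: f g => [f hf] [g hg] /= /funext fg; subst g; congr PMap; exact: Prop_irrelevance.
Qed.

Definition pid (X : pset) : pmap X X := @PMap X X id erefl.

Definition pcomp (X Y Z : pset) (g : pmap Y Z) (f : pmap X Y) : pmap X Z.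
Proof. by exists (g \o f); rewrite /= !pmapP. Defined.

Definition pzero (X Y : pset) : pmap X Y := @PMap X Y (fun=> base) erefl.

(* The object k_+ = {0, ..., k} of Gamma^op; its morphisms k_+ -> l_+ are the
   elements of pmap (plus k) (plus l). *)
Definition plus (k : nat) : pset := PSet (@ord0 k).

Section Quot.
Variables (T : Type) (R : T -> T -> Prop).

Definition quot : Type := {A : set T | exists x, A = clos_refl_sym_trans T R x}.

Definition quot_in (x : T) : quot :=
  exist _ (clos_refl_sym_trans T R x) (ex_intro _ x erefl).

Lemma quot_inP (q : quot) : exists x, q = quot_in x.
Proof. by case: q => A [x e]; exists x; apply: eq_exist; exact: e. Qed.

Lemma quot_in_eq_clos (x y : T) :
  clos_refl_sym_trans T R x y -> quot_in x = quot_in y.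
Proof.
move=> xy; apply: eq_exist; apply/funext => z; apply/propext; split=> h.
  by apply: rst_trans h; apply: rst_sym.
exact: rst_trans h.
Qed.

Lemma quot_in_eq (x y : T) : R x y -> quot_in x = quot_in y.
Proof. by move=> xy; apply: quot_in_eq_clos; apply: rst_step. Qed.

Lemma quot_in_inj (x y : T) :
  quot_in x = quot_in y -> clos_refl_sym_trans T R x y.
Proof.
move=> /(congr1 sval)/(congr1 (fun A : set T => A y)) /= e.
by rewrite e; apply: rst_refl.
Qed.

Definition quot_lift (S : Type) (f : T -> S) (q : quot) : S :=
  f (sval (cid (quot_inP q))).

Lemma quot_liftE (S : Type) (f : T -> S) :
  (forall x y, R x y -> f x = f y) -> forall x, quot_lift f (quot_in x) = f x.
Proof.
move=> Rf x; rewrite /quot_lift; case: cid => y /= /quot_in_inj.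
elim=> [a b /Rf||a b _|a b c _ + _] //; by [|move=> -> ->].
Qed.

End Quot.
Arguments quot_in {T R}.

Section PointedOps.
Variables X Y : pset.

Definition wedge_rel (p q : X + Y) := p = inl base /\ q = inr base.

Definition pwedge : pset := @PSet (quot wedge_rel) (quot_in (inl base)).

Definition on_axes (p : X * Y) := p.1 = base \/ p.2 = base.

(* X /\ Y is X * Y with the axes X * {base} and {base} * Y collapsed. *)
Definition smash_rel (p q : X * Y) := on_axes p /\ on_axes q.

Definition psmash : pset := @PSet (quot smash_rel) (quot_in (base, base)).

Definition winl (x : X) : pwedge := quot_in (inl x).
Definition winr (y : Y) : pwedge := quot_in (inr y).
Definition smash_in (x : X) (y : Y) : psmash := quot_in (x, y).

Lemma winr0 : winr base = base.
Proof. by symmetry; apply: quot_in_eq. Qed.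

Lemma pwedgeP (w : pwedge) : (exists x, w = winl x) \/ (exists y, w = winr y).
Proof.
by case: (quot_inP w) => [] [x|y] ->; [left; exists x|right; exists y].
Qed.

Lemma psmashP (s : psmash) : exists x y, s = smash_in x y.
Proof. by case: (quot_inP s) => [[x y]] ->; exists x, y. Qed.

Lemma smash_in_axes x y : x = base \/ y = base -> smash_in x y = base.
Proof. by move=> h; apply: quot_in_eq; split; [exact: h|left]. Qed.

Lemma smash_in_inj x y x' y' : smash_in x y = smash_in x' y' ->
  (x = x' /\ y = y') \/ (on_axes (x, y) /\ on_axes (x', y')).
Proof.
move=> e; have := quot_in_inj e; clear e.
suff E p q : clos_refl_sym_trans _ smash_rel p q -> p = q \/ smash_rel p q.
  by move=> /E [[-> ->]|]; [left|right].
rewrite /smash_rel; elim=> {p q} [p q|p|p q _|p q r _ + _].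
- by right.
- by left.
- by case=> [->|[? ?]]; [left|right].
- by case=> [->//|[hp hq]] [<-|[_ hr]]; right.
Qed.

Lemma smash_in_base x y : smash_in x y = base -> x = base \/ y = base.
Proof. by move=> /smash_in_inj [[-> _]|[]] //; left. Qed.

Lemma wedge_in_inj (p q : X + Y) : quot_in p = quot_in q :> pwedge ->
  p = q \/ ((p = inl base \/ p = inr base) /\ (q = inl base \/ q = inr base)).
Proof.
move=> e; have := quot_in_inj e; clear e; elim=> {p q} [p q [-> ->]|p|p q _|p q r _ + _].
- by right; split; [left|right].
- by left.
- by case=> [->|[? ?]]; [left|right].
- by case=> [->//|[hp hq]] [<-|[_ hr]]; right.
Qed.

Lemma winl_inj (x x' : X) : winl x = winl x' -> x = x'.
Proof. by case/wedge_in_inj => [e|[[e|e] [e'|e']]]; try split; congruence. Qed.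

Lemma winr_inj (y y' : Y) : winr y = winr y' -> y = y'.
Proof. by case/wedge_in_inj => [e|[[e|e] [e'|e']]]; try split; congruence. Qed.

Lemma winlr (x : X) (y : Y) : winl x = winr y -> x = base /\ y = base.
Proof. by case/wedge_in_inj => [e|[[e|e] [e'|e']]]; try split; congruence. Qed.

End PointedOps.

Definition pwedge_map (X Y X' Y' : pset) (f : pmap X X') (g : pmap Y Y')
  : pmap (pwedge X Y) (pwedge X' Y').
Proof.
exists (quot_lift (fun p => match p with inl x => winl Y' (f x)
                                       | inr y => winr X' (g y) end)).
by rewrite quot_liftE => [|_ _ [-> ->]]; rewrite !pmapP ?winr0.
Defined.

Lemma pwedge_mapl (X Y X' Y' : pset) (f : pmap X X') (g : pmap Y Y') x :
  pwedge_map f g (winl Y x) = winl Y' (f x).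
Proof. by rewrite /= quot_liftE => [|_ _ [-> ->]]; rewrite ?pmapP ?winr0. Qed.

Lemma pwedge_mapr (X Y X' Y' : pset) (f : pmap X X') (g : pmap Y Y') y :
  pwedge_map f g (winr X y) = winr X' (g y).
Proof. by rewrite /= quot_liftE => [|_ _ [-> ->]]; rewrite ?pmapP ?winr0. Qed.

Lemma smash_map_compat (X Y X' Y' : pset) (f : pmap X X') (g : pmap Y Y') p q :
  smash_rel p q -> smash_in (f p.1) (g p.2) = smash_in (f q.1) (g q.2).
Proof.
by case=> hp hq; rewrite !smash_in_axes //;
  [case: hq|case: hp] => ->; rewrite pmapP; [left|right|left|right].
Qed.

Definition psmash_map (X Y X' Y' : pset) (f : pmap X X') (g : pmap Y Y')
  : pmap (psmash X Y) (psmash X' Y').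
Proof.
exists (quot_lift (fun p => smash_in (f p.1) (g p.2))).
by rewrite quot_liftE /= ?pmapP // => p q; apply: smash_map_compat.
Defined.

Lemma psmash_mapE (X Y X' Y' : pset) (f : pmap X X') (g : pmap Y Y') x y :
  psmash_map f g (smash_in x y) = smash_in (f x) (g y).
Proof. by rewrite /= quot_liftE // => p q; apply: smash_map_compat. Qed.

(* Pointed functors from Gamma^op to pointed sets: smod_pointed says that 0_+
   goes to the one-point set. *)
Record Smod := SMod {
  smod_ob :> nat -> pset;
  smod_map : forall k l, pmap (plus k) (plus l) -> pmap (smod_ob k) (smod_ob l);
  smod_id : forall k, smod_map (pid (plus k)) =1 id;
  smod_comp : forall k l m (f : pmap (plus k) (plus l)) (g : pmap (plus l) (plus m)),
    smod_map (pcomp g f) =1 smod_map g \o smod_map f;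
  smod_pointed : forall x : smod_ob 0, x = base }.
Arguments smod_map E {k l} f : rename.

Record Shom (E E' : Smod) := SHom {
  shom_fun :> forall k, pmap (E k) (E' k);
  shom_nat : forall k l (f : pmap (plus k) (plus l)) x,
    shom_fun l (smod_map E f x) = smod_map E' f (shom_fun k x) }.

Definition mutually_inverse (E E' : Smod) (f : Shom E E') (g : Shom E' E) :=
  (forall k, cancel (f k) (g k)) /\ (forall k, cancel (g k) (f k)).

Definition Siso (E E' : Smod) :=
  exists (f : Shom E E') (g : Shom E' E), mutually_inverse f g.

(* The S-module k_+ |-> k_+ /\ F. *)
Definition free_Smod (F : pset) : Smod.
Proof.
exists (fun k => psmash (plus k) F) (fun k l f => psmash_map f (pid F)).
- by move=> k s; have [a [u ->]] := psmashP s; rewrite psmash_mapE.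
- by move=> k l m f g s; have [a [u ->]] := psmashP s; rewrite [RHS](congr1 _ (psmash_mapE _ _ _ _)) !psmash_mapE.
- by move=> s; have [a [u ->]] := psmashP s; rewrite smash_in_axes //; left; rewrite (ord1 a).
Defined.

Definition free_hom (F G : pset) (f : pmap F G) : Shom (free_Smod F) (free_Smod G).
Proof.
exists (fun k => psmash_map (pid (plus k)) f) => k l g s.
by have [a [u ->]] := psmashP s; rewrite !psmash_mapE.
Defined.

Definition wedge_Smod (E1 E2 : Smod) : Smod.
Proof.
exists (fun k => pwedge (E1 k) (E2 k))
  (fun k l f => pwedge_map (smod_map E1 f) (smod_map E2 f)).
- by move=> k w; case: (pwedgeP w) => -[x ->];
    rewrite ?pwedge_mapl ?pwedge_mapr smod_id.
- move=> k l m f g w; case: (pwedgeP w) => -[x ->].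
    by rewrite [RHS](congr1 _ (pwedge_mapl _ _ _)) !pwedge_mapl smod_comp.
  by rewrite [RHS](congr1 _ (pwedge_mapr _ _ _)) !pwedge_mapr smod_comp.
- by move=> w; case: (pwedgeP w) => -[x ->]; rewrite (smod_pointed x) ?winr0.
Defined.

Lemma wedge_Smodl (E1 E2 : Smod) k l (f : pmap (plus k) (plus l)) x :
  smod_map (wedge_Smod E1 E2) f (winl (E2 k) x) = winl (E2 l) (smod_map E1 f x).
Proof. exact: pwedge_mapl. Qed.

Lemma wedge_Smodr (E1 E2 : Smod) k l (f : pmap (plus k) (plus l)) x :
  smod_map (wedge_Smod E1 E2) f (winr (E1 k) x) = winr (E1 l) (smod_map E2 f x).
Proof. exact: pwedge_mapr. Qed.

Definition wedge_hom (E1 E2 E1' E2' : Smod) (T1 : Shom E1 E1') (T2 : Shom E2 E2')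
  : Shom (wedge_Smod E1 E2) (wedge_Smod E1' E2').
Proof.
exists (fun k => pwedge_map (T1 k) (T2 k)) => k l f w.
case: (pwedgeP w) => -[x ->].
  by rewrite wedge_Smodl !pwedge_mapl shom_nat.
by rewrite wedge_Smodr !pwedge_mapr shom_nat.
Defined.

(* The Day-Lydakis smash product: (E1 /\ E2)(k_+) is the colimit, in pointed
   sets, of E1(i_+) /\ E2(j_+) over all pointed maps i_+ /\ j_+ -> k_+.  An
   element is represented by such a map f with x in E1(i_+) and y in E2(j_+);
   day_rel_nat is the colimit relation along pairs of maps i_+ -> i'_+ and
   j_+ -> j'_+, and day_rel_base collapses the axes of E1(i_+) * E2(j_+) and
   identifies all base points. *)
Section DaySmash.
Variables E1 E2 : Smod.

Record day_gen (k : nat) := DayGen {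
  day_i : nat; day_j : nat;
  day_f : pmap (psmash (plus day_i) (plus day_j)) (plus k);
  day_x : E1 day_i;
  day_y : E2 day_j }.
Arguments DayGen {k} [day_i day_j] _ _ _.

Inductive day_rel (k : nat) : day_gen k -> day_gen k -> Prop :=
| day_rel_nat i i' j j' (a : pmap (plus i) (plus i')) (b : pmap (plus j) (plus j'))
    (f : pmap (psmash (plus i') (plus j')) (plus k)) (x : E1 i) (y : E2 j) :
    day_rel (DayGen (pcomp f (psmash_map a b)) x y)
            (DayGen f (smod_map E1 a x) (smod_map E2 b y))
| day_rel_base p q :
    on_axes (day_x p, day_y p) -> on_axes (day_x q, day_y q) -> day_rel p q.

Definition day_in k i j (f : pmap (psmash (plus i) (plus j)) (plus k)) x y
  : quot (@day_rel k) := quot_in (DayGen f x y).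

Definition day_ob (k : nat) : pset :=
  @PSet (quot (@day_rel k)) (@day_in k 0 0 (pzero _ _) base base).

Lemma dayP k (z : day_ob k) : exists i j f x y, z = @day_in k i j f x y.
Proof. by case: (quot_inP z) => -[i j f x y] ->; exists i, j, f, x, y. Qed.

Lemma day_in_nat k i i' j j' (a : pmap (plus i) (plus i')) (b : pmap (plus j) (plus j'))
    (f : pmap (psmash (plus i') (plus j')) (plus k)) (x : E1 i) (y : E2 j) :
  day_in (pcomp f (psmash_map a b)) x y = day_in f (smod_map E1 a x) (smod_map E2 b y).
Proof. by apply: quot_in_eq; constructor. Qed.

Lemma day_in_base k i j (f : pmap (psmash (plus i) (plus j)) (plus k)) x y :
  x = base \/ y = base -> day_in f x y = base :> day_ob k.
Proof. by move=> h; apply: quot_in_eq; constructor => //; left. Qed.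

Lemma day_in_zero k i j (f : pmap (psmash (plus i) (plus j)) (plus k)) x y :
  f =1 pzero _ _ -> day_in f x y = base :> day_ob k.
Proof.
move=> f0; have -> : f = pcomp (pzero _ _)
    (psmash_map (pzero (plus i) (plus 0)) (pid (plus j))).
  by apply: pmap_eq => s; rewrite f0.
by rewrite day_in_nat day_in_base //; left; apply: smod_pointed.
Qed.

Lemma day_map_compat k l (g : pmap (plus k) (plus l)) (p q : day_gen k) :
  day_rel p q ->
  day_in (pcomp g (day_f p)) (day_x p) (day_y p)
  = day_in (pcomp g (day_f q)) (day_x q) (day_y q).
Proof.
case=> [i i' j j' a b f x y|{}p {}q hp hq] /=.
  by rewrite -day_in_nat; congr day_in; apply: pmap_eq.
by rewrite [LHS]day_in_base // [RHS]day_in_base.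
Qed.

Definition day_map k l (g : pmap (plus k) (plus l)) : pmap (day_ob k) (day_ob l).
Proof.
exists (quot_lift (fun p => day_in (pcomp g (day_f p)) (day_x p) (day_y p))).
by rewrite quot_liftE; [apply: day_in_base; left|exact: day_map_compat].
Defined.

Lemma day_mapE k l (g : pmap (plus k) (plus l)) i j
    (f : pmap (psmash (plus i) (plus j)) (plus k)) x y :
  day_map g (day_in f x y) = day_in (pcomp g f) x y.
Proof. by rewrite /= quot_liftE //; exact: day_map_compat. Qed.

Definition smash_Smod : Smod.
Proof.
exists day_ob day_map.
- move=> k z; have [i [j [f [x [y ->]]]]] := dayP z; rewrite day_mapE.
  by congr day_in; apply: pmap_eq.
- move=> k l m f g z; have [i [j [h [x [y ->]]]]] := dayP z.
  rewrite [RHS](congr1 _ (day_mapE _ _ _ _)) !day_mapE.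
  by congr day_in; apply: pmap_eq.
- move=> z; have [i [j [h [x [y ->]]]]] := dayP z.
  by apply: day_in_zero => s /=; rewrite (ord1 (h s)).
Defined.

End DaySmash.

Section SmashHom.
Variables (E1 E2 E1' E2' : Smod) (T1 : Shom E1 E1') (T2 : Shom E2 E2').

Lemma smash_hom_compat k (p q : day_gen E1 E2 k) : day_rel p q ->
  day_in (day_f p) (T1 _ (day_x p)) (T2 _ (day_y p))
  = day_in (day_f q) (T1 _ (day_x q)) (T2 _ (day_y q)).
Proof.
case=> [i i' j j' a b f x y|{}p {}q hp hq] /=.
  by rewrite day_in_nat -!shom_nat.
rewrite [LHS]day_in_base; last first.
  by case: hp => /= ->; rewrite pmapP; [left|right].
by rewrite [RHS]day_in_base //; case: hq => /= ->; rewrite pmapP; [left|right].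
Qed.

Definition smash_hom_ob k : pmap (day_ob E1 E2 k) (day_ob E1' E2' k).
Proof.
exists (quot_lift (fun p => day_in (day_f p) (T1 _ (day_x p)) (T2 _ (day_y p)))).
by rewrite quot_liftE /= ?pmapP //; exact: smash_hom_compat.
Defined.

Lemma smash_hom_obE k i j (f : pmap (psmash (plus i) (plus j)) (plus k)) x y :
  smash_hom_ob k (day_in f x y) = day_in f (T1 _ x) (T2 _ y).
Proof. by rewrite /= quot_liftE //; exact: smash_hom_compat. Qed.

Definition smash_hom : Shom (smash_Smod E1 E2) (smash_Smod E1' E2').
Proof.
exists smash_hom_ob => k l g z; have [i [j [f [x [y ->]]]]] := dayP z.
by rewrite [smod_map _ _ _]day_mapE !smash_hom_obE [RHS]day_mapE.
Defined.

End SmashHom.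

Section Image.
Variables (E E' : Smod) (T : Shom E E').

Definition image_ob (k : nat) : pset :=
  @PSet {y : E' k | exists x, T k x = y} (exist _ base (ex_intro _ base (pmapP (T k)))).

Definition image_map k l (f : pmap (plus k) (plus l)) : pmap (image_ob k) (image_ob l).
Proof.
unshelve refine (@PMap (image_ob k) (image_ob l)
  (fun y => exist _ (smod_map E' f (sval y)) _) _).
  by case: y => y [x xy] /=; exists (smod_map E f x); rewrite shom_nat xy.
by apply: eq_exist; rewrite /= pmapP.
Defined.

Definition image_Smod : Smod.
Proof.
exists image_ob image_map.
- by move=> k [y hy]; apply: eq_exist; rewrite /= smod_id.
- by move=> k l m f g [y hy]; apply: eq_exist; rewrite /= smod_comp.
- by move=> [y hy]; apply: eq_exist; rewrite /= (smod_pointed y).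
Defined.

End Image.

Definition image_endo (E : Smod) (T : Shom E E) : Shom (image_Smod T) (image_Smod T).
Proof.
unshelve refine (@SHom (image_Smod T) (image_Smod T) (fun k =>
  @PMap (image_ob T k) (image_ob T k) (fun y => exist _ (T k (sval y)) _) _) _).
- by case: y => y hy /=; exists y.
- by apply: eq_exist; rewrite /= pmapP.
- by move=> k l f [y hy]; apply: eq_exist; rewrite /= shom_nat.
Defined.

Definition classC (E : Smod) : Prop :=
  exists F : pset, finite_set [set: F] /\ Siso E (free_Smod F).

Definition one_plus : plus 1 := ord_max.

(* The morphism from 1_+ to k_+ selecting c. *)
Definition sel k (c : plus k) : pmap (plus 1) (plus k) :=
  @PMap (plus 1) (plus k) (fun i => if i == ord0 then ord0 else c) erefl.

Lemma plus1P (a : plus 1) : a = base \/ a = one_plus.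
Proof. by case: a => [[|[|//]] h]; [left|right]; apply: val_inj. Qed.

Lemma pcomp_sel k l (f : pmap (plus k) (plus l)) c : pcomp f (sel c) = sel (f c).
Proof. by apply: pmap_eq => i /=; case: eqP => // _; exact: (pmapP f). Qed.

Lemma sel0 k : sel (base : plus k) = pzero _ _.
Proof. by apply: pmap_eq => i /=; case: eqP. Qed.

Lemma smod_map0 (E : Smod) k l x : smod_map E (pzero (plus k) (plus l)) x = base.
Proof.
have -> : pzero (plus k) (plus l) = pcomp (pzero (plus 0) (plus l)) (pzero (plus k) (plus 0)).
  exact: pmap_eq.
by rewrite smod_comp /= (smod_pointed (smod_map E _ x)) pmapP.
Qed.

(* free_fin is an elementwise description of classC, used only to show that
   classC is closed under images, wedges and smash products. *)
Definition spanned (E : Smod) :=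
  forall k (y : E k), exists (c : plus k) (u : E 1), y = smod_map E (sel c) u.

Definition freely (E : Smod) :=
  forall k (c c' : plus k) (u u' : E 1),
    smod_map E (sel c) u = smod_map E (sel c') u' ->
    (c = c' /\ u = u') \/ (on_axes (c, u) /\ on_axes (c', u')).

Definition free_fin (E : Smod) := [/\ finite_set [set: E 1], spanned E & freely E].

Lemma finite_surj (T S : Type) (f : T -> S) :
  finite_set [set: T] -> (forall y, exists x, y = f x) -> finite_set [set: S].
Proof.
move=> finT fs; have -> : [set: S]%classic = [set f x | x in [set: T]]%classic.
  by apply/seteqP; split=> y // _; have [x ->] := fs y; exists x.
exact: finite_image.
Qed.

Lemma finite_inj (T S : Type) (f : S -> T) :
  finite_set [set: T] -> injective f -> finite_set [set: S].
Proof.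
move=> finT fi; have [[s0 _]|S0] := pselect (exists s : S, True); last first.
  suff -> : [set: S]%classic = set0%classic by [].
  by apply/seteqP; split=> s // _; case: S0; exists s.
pose g t := if pselect (exists s, f s = t) is left h then sval (cid h) else s0.
apply: (finite_surj (f := g) finT) => s; exists (f s); rewrite /g.
by case: pselect => [h|[]]; [case: cid => /= s' /fi|exists s].
Qed.

Lemma free_fin_free (F : pset) : finite_set [set: F] -> free_fin (free_Smod F).
Proof.
move=> finF; have E k (c : plus k) a u : smod_map (free_Smod F) (sel c) (smash_in a u)
    = smash_in (sel c a) u by rewrite [LHS]psmash_mapE.
split.
- apply: (finite_surj (f := fun p : 'I_2 * F => smash_in (p.1 : plus 1) p.2)).
    by rewrite -setXTT; apply: finite_setX.
  by move=> y; have [a [u ->]] := psmashP y; exists (a, u).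
- move=> k y; have [c [u ->]] := psmashP y.
  by exists c, (smash_in one_plus u); rewrite E.
- move=> k c c' s s'; have [a [u ->]] := psmashP s; have [a' [u' ->]] := psmashP s'.
  rewrite !E.
  have ax (b : plus 1) (d : plus k) (v : F) : on_axes (sel d b : plus k, v) ->
      on_axes (d, smash_in b v).
    case=> /= [h|->]; last by right; rewrite smash_in_axes //; right.
    have [->|e] := plus1P b; first by right; rewrite smash_in_axes //; left.
    by left; move: h; rewrite e.
  case/smash_in_inj => [[e ->]|[/ax ? /ax ?]]; last by right.
  have [ea|ea] := plus1P a.
    right; split; apply: ax; [|rewrite -e]; left; rewrite ea; exact: pmapP.
  have [ea'|ea'] := plus1P a'.
    right; split; apply: ax; [rewrite e|]; left; rewrite ea'; exact: pmapP.
  by left; move: e; rewrite ea ea' /= => ->.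
Qed.

Lemma free_fin_iso (E E' : Smod) : Siso E E' -> free_fin E' -> free_fin E.
Proof.
case=> f [g [fK gK]] [finE' sp fr]; split.
- by apply: finite_inj finE' (can_inj (fK 1)).
- move=> k y; have [c [u e]] := sp k (f k y); exists c, (g 1 u).
  by rewrite -shom_nat -e fK.
- move=> k c c' u u' /(congr1 (f k)); rewrite !shom_nat => /fr.
  have ax (d : plus k) (v : E 1) : on_axes (d, f 1 v) -> on_axes (d, v).
    case=> /= [->|h]; [by left|right=> /=].
    by rewrite -(fK 1 v) h pmapP.
  case=> [[-> /(can_inj (fK 1)) ->]|[/ax ? /ax ?]]; [by left|by right].
Qed.

Lemma classC_free_fin (E : Smod) : classC E -> free_fin E.
Proof. by case=> F [/free_fin_free finF /free_fin_iso]; apply. Qed.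

Section FromFree.
Variable E : Smod.

Lemma from_free_compat k (p q : plus k * E 1) : smash_rel p q ->
  smod_map E (sel p.1) p.2 = smod_map E (sel q.1) q.2.
Proof.
by case=> -[] -> -[] ->; rewrite ?sel0 ?smod_map0 ?pmapP.
Qed.

Definition from_free_ob k : pmap (psmash (plus k) (E 1)) (E k).
Proof.
exists (quot_lift (fun p => smod_map E (sel p.1) p.2)).
by rewrite quot_liftE ?pmapP //; exact: from_free_compat.
Defined.

Lemma from_freeE k (c : plus k) u :
  from_free_ob k (smash_in c u) = smod_map E (sel c) u.
Proof. by rewrite /= quot_liftE //; exact: from_free_compat. Qed.

Definition from_free : Shom (free_Smod (E 1)) E.
Proof.
exists from_free_ob => k l f s; have [c [u ->]] := psmashP s.
by rewrite [smod_map _ _ _]psmash_mapE !from_freeE -pcomp_sel smod_comp.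
Defined.

Lemma free_fin_classC : free_fin E -> classC E.
Proof.
case=> finE sp fr; exists (E 1); split=> //.
have surj k (y : E k) : exists s, from_free k s = y.
  have [c [u ->]] := sp k y; exists (smash_in c u); exact: from_freeE.
have inj k : injective (from_free k).
  move=> s s'; have [c [u ->]] := psmashP s; have [c' [u' ->]] := psmashP s'.
  rewrite !from_freeE => /fr [[-> ->]//|[h h']].
  by rewrite !smash_in_axes.
pose g k y := sval (cid (surj k y)).
have gK k : cancel (g k) (from_free k) by move=> y; exact: svalP (cid (surj k y)).
have g0 k : g k base = base by apply: (inj k); rewrite gK pmapP.
have gnat k l (f : pmap (plus k) (plus l)) x :
    PMap (g0 l) (smod_map E f x) = smod_map (free_Smod (E 1)) f (PMap (g0 k) x).
  by apply: (inj l); rewrite shom_nat; apply: etrans (gK _ _) _; congr (smod_map E f _); exact/esym/gK.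
exists (SHom gnat), from_free; split=> k y; first exact: gK.
by apply: (inj k); exact: gK.
Qed.

End FromFree.

Lemma classC_image (E : Smod) (T : Shom E E) : classC E -> classC (image_Smod T).
Proof.
move=> /classC_free_fin [finE sp fr]; apply: free_fin_classC; split.
- apply: (finite_inj (f := fun y : image_Smod T 1 => sval y) finE).
  by move=> [y hy] [z hz] /= e; apply: eq_exist.
- move=> k [y [x xy]]; have [c [u e]] := sp k x.
  exists c, (exist _ (T 1 u) (ex_intro _ u erefl)); apply: eq_exist => /=.
  by rewrite -shom_nat -e.
- move=> k c c' [y hy] [y' hy'] /(congr1 sval) /= /fr.
  have ax (d : plus k) z hz : on_axes (d, z) ->
      on_axes (d, exist _ z hz : image_Smod T 1).
    by case=> /= [->|h]; [left|right; apply: eq_exist].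
  case=> [[-> e]|[/ax h /ax h']]; [left; split=> //; exact: eq_exist|right].
  by split.
Qed.

Lemma classC_wedge (E1 E2 : Smod) : classC E1 -> classC E2 -> classC (wedge_Smod E1 E2).
Proof.
move=> /classC_free_fin [fin1 sp1 fr1] /classC_free_fin [fin2 sp2 fr2].
apply: free_fin_classC; split.
- apply: (finite_surj (f := fun p : E1 1 * E2 1 * bool =>
    if p.2 then winl _ p.1.1 else winr _ p.1.2)).
    by rewrite -!setXTT; do 2?apply: finite_setX.
  by move=> w; case: (pwedgeP w) => -[x ->]; [exists (x, base, true)|exists (base, x, false)].
- move=> k w; case: (pwedgeP w) => -[x ->].
    by have [c [u ->]] := sp1 k x; exists c, (winl _ u); rewrite wedge_Smodl.
  by have [c [u ->]] := sp2 k x; exists c, (winr _ u); rewrite wedge_Smodr.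
- have axl k (c : plus k) u : smod_map E1 (sel c) u = base -> on_axes (c, winl (E2 1) u).
    move=> e; have : smod_map E1 (sel c) u = smod_map E1 (sel c) base by rewrite e pmapP.
    by case/fr1 => [[_ ->]|[[/= ->|/= ->] _]]; [right|left|right].
  have axr k (c : plus k) u : smod_map E2 (sel c) u = base -> on_axes (c, winr (E1 1) u).
    move=> e; have : smod_map E2 (sel c) u = smod_map E2 (sel c) base by rewrite e pmapP.
    by case/fr2 => [[_ ->]|[[/= ->|/= ->] _]]; [right|left|right]; rewrite //= ?winr0.
  move=> k c c' w w'; case: (pwedgeP w) => -[u ->]; case: (pwedgeP w') => -[u' ->];
    rewrite ?wedge_Smodl ?wedge_Smodr.
  + move=> /winl_inj e; case: (fr1 k c c' u u' e) => [[-> ->]|[h h']]; first by left.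
    by right; split; [case: h|case: h'] => /= ->; by [left|right].
  + move=> /winlr [e e']; right; split; [exact: axl|exact: axr].
  + move=> /esym/winlr [e e']; right; split; [exact: axr|exact: axl].
  + move=> /winr_inj e; case: (fr2 k c c' u u' e) => [[-> ->]|[h h']]; first by left.
    by right; split; [case: h|case: h'] => /= ->; rewrite ?winr0; by [left|right].
Qed.

Section DayClosure.
Variables E1 E2 : Smod.
Hypotheses (ff1 : free_fin E1) (ff2 : free_fin E2).

Definition one_one : pmap (psmash (plus 1) (plus 1)) (plus 1).
Proof.
exists (quot_lift (fun p => if (p.1 == ord0) || (p.2 == ord0) then ord0 else ord_max)).
rewrite quot_liftE //= => -[a b] [a' b'] [[] /= -> [] /= ->];
  by rewrite eqxx ?orbT.
Defined.

Lemma one_oneE a b : one_one (smash_in a b)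
  = if (a == ord0) || (b == ord0) then ord0 else ord_max.
Proof.
rewrite /= quot_liftE // => -[{}a {}b] [a' b'] [[] /= -> [] /= ->];
  by rewrite eqxx ?orbT.
Qed.

Definition unit_gen (u : E1 1) (v : E2 1) : smash_Smod E1 E2 1 :=
  day_in one_one u v.

Lemma smash_Smod_in k l (g : pmap (plus k) (plus l)) i j
    (f : pmap (psmash (plus i) (plus j)) (plus k)) (x : E1 i) (y : E2 j) :
  smod_map (smash_Smod E1 E2) g (day_in f x y) = day_in (pcomp g f) x y.
Proof. exact: day_mapE. Qed.

Lemma day_in_sel k i j (f : pmap (psmash (plus i) (plus j)) (plus k))
    (a : plus i) (b : plus j) (u : E1 1) (v : E2 1) :
  day_in f (smod_map E1 (sel a) u) (smod_map E2 (sel b) v)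
  = smod_map (smash_Smod E1 E2) (sel (f (smash_in a b))) (unit_gen u v).
Proof.
rewrite /unit_gen smash_Smod_in -day_in_nat; congr day_in; apply: pmap_eq => s.
have [c [d ->]] := psmashP s; rewrite [LHS](congr1 f (psmash_mapE _ _ _ _)).
rewrite [RHS](congr1 (sel _) (one_oneE _ _)) /=.
case: eqP => /= _; first by rewrite smash_in_axes ?pmapP //; left.
by case: eqP => /= _; first by rewrite smash_in_axes ?pmapP //; right.
Qed.

Lemma day_spanned k (z : smash_Smod E1 E2 k) :
  exists c u v, z = smod_map (smash_Smod E1 E2) (sel c) (unit_gen u v).
Proof.
have [i [j [f [x [y ->]]]]] := dayP z.
case: ff1 => _ /(_ i x) [a [u ->]] _; case: ff2 => _ /(_ j y) [b [v ->]] _.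
by exists (f (smash_in a b)), u, v; rewrite -day_in_sel.
Qed.

Lemma coord_ex (E : Smod) : free_fin E -> forall k (x : E k),
  exists s : psmash (plus k) (E 1), forall c u, smod_map E (sel c) u = x -> s = smash_in c u.
Proof.
case=> _ sp fr k x; have [c [u ->]] := sp k x; exists (smash_in c u) => c' u' /fr.
by case=> [[-> ->]//|[h h']]; rewrite !smash_in_axes.
Qed.

Definition coord (E : Smod) (ff : free_fin E) k (x : E k) : psmash (plus k) (E 1) :=
  sval (cid (coord_ex ff x)).

Lemma coordE (E : Smod) (ff : free_fin E) k (c : plus k) u :
  coord ff (smod_map E (sel c) u) = smash_in c u.
Proof. by rewrite /coord; case: cid => s /=; exact. Qed.

Lemma coord_nat (E : Smod) (ff : free_fin E) k l (f : pmap (plus k) (plus l)) x :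
  coord ff (smod_map E f x) = psmash_map f (pid (E 1)) (coord ff x).
Proof.
have [_ sp _] := ff; have [c [u ->]] := sp k x.
have e : smod_map E f (smod_map E (sel c) u) = smod_map E (sel (f c)) u.
  by rewrite -pcomp_sel smod_comp.
by rewrite e !coordE psmash_mapE.
Qed.

Lemma coord0 (E : Smod) (ff : free_fin E) k : coord ff (base : E k) = base.
Proof.
have <- : smod_map E (sel base) (base : E 1) = base :> E k by rewrite pmapP.
by rewrite coordE smash_in_axes //; left.
Qed.

Definition shuffle (A B C D : pset) (s : psmash A C) (t : psmash B D)
  : psmash (psmash A B) (psmash C D) :=
  quot_lift (fun p => quot_lift (fun q =>
    smash_in (smash_in p.1 q.1) (smash_in p.2 q.2) : psmash (psmash A B) (psmash C D)) t) s.

Lemma shuffleE (A B C D : pset) (a : A) (b : B) (c : C) (d : D) :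
  shuffle (smash_in a c) (smash_in b d) = smash_in (smash_in a b) (smash_in c d).
Proof.
have in2 (p : A * C) : forall q q' : B * D, smash_rel q q' ->
  smash_in (smash_in p.1 q.1) (smash_in p.2 q.2) =
  smash_in (smash_in p.1 q'.1) (smash_in p.2 q'.2).
  have z (q : B * D) : on_axes q -> smash_in (smash_in p.1 q.1) (smash_in p.2 q.2) = base.
    by case=> ->; apply: smash_in_axes; [left|right]; apply: smash_in_axes; right.
  by move=> q q' [/z -> /z ->].
rewrite /shuffle quot_liftE; first by rewrite quot_liftE //; exact: (in2 (a, c)).
move=> p p' [hp hp']; rewrite (quot_liftE (in2 p)) (quot_liftE (in2 p')) /=.
have z (r : A * C) : on_axes r -> smash_in (smash_in r.1 b) (smash_in r.2 d) = base.
  by case=> ->; apply: smash_in_axes; [left|right]; apply: smash_in_axes; left.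
by rewrite !z.
Qed.

Lemma shuffle0l (A B C D : pset) (t : psmash B D) :
  shuffle (base : psmash A C) t = base.
Proof.
have [b [d ->]] := psmashP t; rewrite [LHS]shuffleE.
by apply: smash_in_axes; left; apply: smash_in_axes; left.
Qed.

Lemma shuffle0r (A B C D : pset) (s : psmash A C) :
  shuffle s (base : psmash B D) = base.
Proof.
have [b [d ->]] := psmashP s; rewrite [LHS]shuffleE.
by apply: smash_in_axes; left; apply: smash_in_axes; right.
Qed.

Definition day_coord k (z : smash_Smod E1 E2 k) : psmash (plus k) (psmash (E1 1) (E2 1)) :=
  quot_lift (fun p => psmash_map (day_f p) (pid _)
    (shuffle (coord ff1 (day_x p)) (coord ff2 (day_y p)))) z.

Lemma day_coord_compat k (p q : day_gen E1 E2 k) : day_rel p q ->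
  psmash_map (day_f p) (pid _) (shuffle (coord ff1 (day_x p)) (coord ff2 (day_y p)))
  = psmash_map (day_f q) (pid _) (shuffle (coord ff1 (day_x q)) (coord ff2 (day_y q))).
Proof.
case=> [i i' j j' a b f x y|{}p {}q hp hq].
  cbn [day_f day_x day_y day_i day_j]; rewrite !coord_nat.
  have [c [u ->]] := psmashP (coord ff1 x); have [d [v ->]] := psmashP (coord ff2 y).
  rewrite (psmash_mapE a) (psmash_mapE b) !shuffleE.
  by rewrite (psmash_mapE f) (psmash_mapE (pcomp f _)) [LHS](congr1 (fun z => smash_in (f z) _) (psmash_mapE _ _ _ _)).
have z (r : day_gen E1 E2 k) : on_axes (day_x r, day_y r) ->
    psmash_map (day_f r) (pid _)
      (shuffle (coord ff1 (day_x r)) (coord ff2 (day_y r))) = base.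
  case=> h; [change (day_x r = base) in h|change (day_y r = base) in h];
    by rewrite h coord0 ?shuffle0l ?shuffle0r pmapP.
by rewrite [LHS]z // [RHS]z.
Qed.

Lemma day_coordE k (c : plus k) u v :
  day_coord (smod_map (smash_Smod E1 E2) (sel c) (unit_gen u v))
  = smash_in c (smash_in u v).
Proof.
rewrite smash_Smod_in /day_coord quot_liftE; last exact: day_coord_compat.
cbn [day_f day_x day_y day_i day_j].
have i1 (E : Smod) (w : E 1) : w = smod_map E (sel one_plus) w.
  rewrite -[LHS](smod_id w); congr (smod_map E _ w); apply: pmap_eq => i /=.
  by have [->|->] := plus1P i.
have cu (E : Smod) (ff : free_fin E) w : coord ff w = smash_in one_plus w.
  exact: etrans (congr1 (@coord E ff 1) (i1 E w)) (coordE ff one_plus w).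
rewrite !cu shuffleE psmash_mapE.
by congr smash_in; rewrite [LHS](congr1 (sel c) (one_oneE _ _)).
Qed.

Lemma free_fin_smash : free_fin (smash_Smod E1 E2).
Proof.
case: (ff1) => fin1 _ _; case: (ff2) => fin2 _ _; split.
- apply: (finite_surj (f := fun p : 'I_2 * (E1 1 * E2 1) =>
    smod_map (smash_Smod E1 E2) (sel (p.1 : plus 1)) (unit_gen p.2.1 p.2.2))).
    by rewrite -!setXTT; do 2?apply: finite_setX.
  by move=> z; have [c [u [v ->]]] := day_spanned z; exists (c, (u, v)).
- by move=> k z; have [c [u [v ->]]] := day_spanned z; exists c, (unit_gen u v).
- move=> k c c' w w'.
  have [d [u [v ->]]] := day_spanned w; have [d' [u' [v' ->]]] := day_spanned w'.
  have E (e : plus k) b x y :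
     smod_map (smash_Smod E1 E2) (sel e)
       (smod_map (smash_Smod E1 E2) (sel b) (unit_gen x y))
     = smod_map (smash_Smod E1 E2) (sel (sel e b)) (unit_gen x y).
    by rewrite -pcomp_sel smod_comp.
  rewrite !E => /(congr1 (@day_coord k)); rewrite !day_coordE.
  have z b x y : smash_in x y = base :> psmash (E1 1) (E2 1) ->
      smod_map (smash_Smod E1 E2) (sel (b : plus 1)) (unit_gen x y) = base.
    by move=> /smash_in_base h; rewrite smash_Smod_in day_in_base.
  have ax (e : plus k) b x y : on_axes (sel e b : plus k, smash_in x y : psmash (E1 1) (E2 1)) ->
      on_axes (e, smod_map (smash_Smod E1 E2) (sel b) (unit_gen x y)).
    case=> [h|/z h]; last by right; exact: h.
    have [eb|eb] := plus1P b; last by left; rewrite eb in h; exact: h.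
    by right; rewrite eb sel0; exact: smod_map0.
  case/smash_in_inj => [[e f]|[/ax ? /ax ?]]; last by right.
  have [ed|ed] := plus1P d.
    right; split; apply: ax; [|rewrite -e]; left; rewrite ed; exact: pmapP.
  have [ed'|ed'] := plus1P d'.
    right; split; apply: ax; [rewrite e|]; left; rewrite ed'; exact: pmapP.
  case/smash_in_inj: f => [[-> ->]|[h h']].
    by left; move: e; rewrite ed ed' /= => ->.
  by right; split; apply: ax; right; apply: smash_in_axes.
Qed.

End DayClosure.

Lemma classC_smash (E1 E2 : Smod) : classC E1 -> classC E2 -> classC (smash_Smod E1 E2).
Proof.
move=> /classC_free_fin h1 /classC_free_fin h2.
exact/free_fin_classC/free_fin_smash.
Qed.

Lemma classC_free (F : pset) : finite_set [set: F] -> classC (free_Smod F).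
Proof. by move=> finF; apply: free_fin_classC; apply: free_fin_free. Qed.

Lemma finite_plus k : finite_set [set: plus k].
Proof. exact: finite_finset. Qed.

Record EndC := MkEndC {
  end_mod :> Smod;
  end_map : Shom end_mod end_mod;
  end_class : classC end_mod }.

Definition end_iso (P Q : EndC) : Prop :=
  exists (f : Shom P Q) (g : Shom Q P), mutually_inverse f g /\
    forall k (x : P k), f k (end_map P k x) = end_map Q k (f k x).

Definition end_image (P : EndC) : EndC :=
  MkEndC (image_endo (end_map P)) (classC_image (end_map P) (end_class P)).

Definition end_wedge (P Q : EndC) : EndC :=
  MkEndC (wedge_hom (end_map P) (end_map Q))
         (classC_wedge (end_class P) (end_class Q)).

Definition end_smash (P Q : EndC) : EndC :=
  MkEndC (smash_hom (end_map P) (end_map Q))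
         (classC_smash (end_class P) (end_class Q)).

Definition end_free (F : pset) (finF : finite_set [set: F]) (t : pmap F F) : EndC :=
  MkEndC (free_hom t) (classC_free finF).

Local Open Scope ring_scope.

Definition additive_invariant (A : zmodType) (chi : EndC -> A) : Prop :=
  [/\ forall P Q, end_iso P Q -> chi P = chi Q,
      forall P, chi P = chi (end_image P) &
      forall P Q, chi (end_wedge P Q) = chi P + chi Q].

Definition universal_invariant (W : zmodType) (chi : EndC -> W) : Prop :=
  additive_invariant chi /\
  forall (A : zmodType) (psi : EndC -> A), additive_invariant psi ->
    exists h : {additive W -> A}, psi =1 h \o chi /\
      forall h' : {additive W -> A}, psi =1 h' \o chi -> h' =1 h.

(* W_0(S), specified by its universal property; since the classes witt_class P
   generate the additive group, witt_smash determines the product. *)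
Record global_Witt_ring := GlobalWittRing {
  witt_ring :> comPzRingType;
  witt_class : EndC -> witt_ring;
  witt_universal : universal_invariant witt_class;
  witt_smash : forall P Q, witt_class (end_smash P Q) = witt_class P * witt_class Q }.

(* monalg only gives {malg R[K]} a product when the only unit of the monoid K
   is its neutral element, which excludes groups; hence the type alias with
   its own ring structure. *)
Definition group_ring (V : zmodType) : Type := {malg int[V]}.

HB.instance Definition _ (V : zmodType) := GRing.Zmodule.on (group_ring V).

Definition gr_elt (V : zmodType) (g : V) : group_ring V := << g >>.

Section GroupRing.
Local Open Scope fset_scope.
Variable V : zmodType.
Implicit Types x y z : group_ring V.

Definition gr_mul x y : group_ring V :=
  \sum_(g <- msupp x) \sum_(h <- msupp y) << x@_g * y@_h *g (g + h)%R >>.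

Lemma gr_mulw (d1 d2 : {fset V}) x y :
  msupp x `<=` d1 -> msupp y `<=` d2 ->
  gr_mul x y = \sum_(g <- d1) \sum_(h <- d2) << x@_g * y@_h *g (g + h)%R >>.
Proof.
move=> le_d1 le_d2; rewrite /gr_mul (big_fset_incl _ le_d1) /=.
  apply/eq_bigr=> k1 _; apply/big_fset_incl => // k _ /mcoeff_outdom ->.
  by rewrite mulr0 monalgU0.
move=> k _ /mcoeff_outdom g1k.
by rewrite big1 => // k' _; rewrite g1k mul0r monalgU0.
Qed.

Lemma gr_mulUU c d (g h : V) :
  gr_mul << c *g g >> << d *g h >> = << c * d *g (g + h)%R >>.
Proof. by rewrite (gr_mulw msuppU_le msuppU_le) !big_seq_fset1 !mcoeffUU. Qed.

Lemma gr_mulC : commutative gr_mul.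
Proof.
move=> x y; rewrite /gr_mul exchange_big /=; apply: eq_bigr => h _.
by apply: eq_bigr => g _; rewrite mulrC addrC.
Qed.

Lemma gr_mulDl : left_distributive gr_mul +%R.
Proof.
move=> x y z.
rewrite [in RHS](gr_mulw (fsubsetUl _ (msupp y)) (fsubset_refl _)).
rewrite [in RHS](gr_mulw (fsubsetUr (msupp x) _) (fsubset_refl _)).
rewrite (gr_mulw (msuppD_le _ _) (fsubset_refl _)).
rewrite -big_split /=; apply/eq_bigr=> k1 _.
rewrite -big_split /=; apply/eq_bigr=> k2 _.
by rewrite mcoeffD mulrDl monalgUD.
Qed.

Lemma gr_mulDr : right_distributive gr_mul +%R.
Proof. by move=> x y z; rewrite ![gr_mul x _]gr_mulC gr_mulDl. Qed.

Lemma gr_mul0l : left_zero 0 gr_mul.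
Proof. by move=> x; rewrite /gr_mul msupp0 big_seq_fset0. Qed.

Lemma gr_mul0r : right_zero 0 gr_mul.
Proof. by move=> x; rewrite gr_mulC gr_mul0l. Qed.

Lemma gr_mul_suml (I : Type) (r : seq I) (F : I -> group_ring V) y :
  gr_mul (\sum_(i <- r) F i) y = \sum_(i <- r) gr_mul (F i) y.
Proof. exact: (big_morph (gr_mul^~ y) (fun _ _ => gr_mulDl _ _ _) (gr_mul0l _)). Qed.

Lemma gr_mul_sumr (I : Type) (r : seq I) (F : I -> group_ring V) x :
  gr_mul x (\sum_(i <- r) F i) = \sum_(i <- r) gr_mul x (F i).
Proof. exact: (big_morph (gr_mul x) (fun _ _ => gr_mulDr _ _ _) (gr_mul0r _)). Qed.

Lemma gr_mulA : associative gr_mul.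
Proof.
move=> x y z; rewrite [x]monalgE [LHS]gr_mul_suml.
rewrite [in RHS](gr_mul_suml _ _ y) [RHS]gr_mul_suml; apply: eq_bigr => g _.
rewrite [y]monalgE (gr_mul_suml _ _ z) !gr_mul_sumr [RHS]gr_mul_suml.
apply: eq_bigr => h _.
rewrite [z]monalgE (gr_mul_sumr _ _ << y@_h *g h >>) [LHS]gr_mul_sumr.
rewrite [RHS]gr_mul_sumr; apply: eq_bigr => k _.
by rewrite !gr_mulUU mulrA addrA.
Qed.

Lemma gr_mul1 : left_id (gr_elt (0 : V)) gr_mul.
Proof.
move=> x; rewrite [x]monalgE gr_mul_sumr; apply: eq_bigr => g _.
by rewrite gr_mulUU mul1r add0r.
Qed.

Lemma gr_one_neq0 : gr_elt (0 : V) != 0.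
Proof. by rewrite /gr_elt monalgU_eq0. Qed.

HB.instance Definition _ := GRing.Zmodule_isComNzRing.Build (group_ring V)
  gr_mulA gr_mulC gr_mul1 gr_mulDl gr_one_neq0.

End GroupRing.

Record zaut (V : zmodType) := ZAut {
  zaut_fun :> V -> V;
  zautD : {morph zaut_fun : x y / x + y};
  zaut_bij : bijective zaut_fun }.

Definition zaut_comp (V : zmodType) (u v : zaut V) : zaut V.
Proof.
exists (u \o v); first by move=> x y /=; rewrite !zautD.
exact: bij_comp (zaut_bij u) (zaut_bij v).
Defined.

Definition gr_act (V : zmodType) (u : zaut V) (x : group_ring V)
  : group_ring V := \sum_(g <- msupp x) << x@_g *g u g >>.

Section Invariants.
Variable V : zmodType.
Implicit Types (x y : group_ring V) (u : zaut V).

Lemma zaut0 u : u 0 = 0.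
Proof. by apply: (addrI (u 0)); rewrite -zautD !addr0. Qed.

Lemma gr_actw (d : {fset V}) u x : (msupp x `<=` d)%fset ->
  gr_act u x = \sum_(g <- d) << x@_g *g u g >>.
Proof.
move=> le_d; rewrite /gr_act (big_fset_incl _ le_d) //= => k _ /mcoeff_outdom ->.
by rewrite monalgU0.
Qed.

Lemma gr_actU u c (g : V) : gr_act u << c *g g >> = << c *g u g >>.
Proof. by rewrite (gr_actw _ msuppU_le) big_seq_fset1 mcoeffUU. Qed.

Lemma gr_actD u : {morph gr_act u : x y / x + y}.
Proof.
move=> x y; rewrite (gr_actw _ (msuppD_le _ _)).
rewrite (gr_actw _ (fsubsetUl _ (msupp y))) (gr_actw _ (fsubsetUr (msupp x) _)).
by rewrite -big_split; apply: eq_bigr => g _; rewrite mcoeffD monalgUD.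
Qed.

Lemma gr_act0 u : gr_act u 0 = 0.
Proof. by rewrite /gr_act msupp0 big_seq_fset0. Qed.

Lemma gr_actN u : {morph gr_act u : x / - x}.
Proof.
by move=> x; apply: (addrI (gr_act u x)); rewrite -gr_actD !subrr gr_act0.
Qed.

Lemma gr_act_sum u (I : Type) (r : seq I) (F : I -> group_ring V) :
  gr_act u (\sum_(i <- r) F i) = \sum_(i <- r) gr_act u (F i).
Proof. exact: (big_morph _ (gr_actD u) (gr_act0 u)). Qed.

Lemma gr_actM u : {morph gr_act u : x y / x * y}.
Proof.
move=> x y; have E (z : group_ring V) :
  z = \sum_(g <- msupp z) (<< z@_g *g g >> : group_ring V) by exact: monalgE.
have MU c d (g h : V) : (<< c *g g >> : group_ring V) * << d *g h >>
    = << c * d *g (g + h)%R >> by exact: gr_mulUU.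
rewrite [x]E mulr_suml !gr_act_sum mulr_suml; apply: eq_bigr => g _.
rewrite [y]E mulr_sumr !gr_act_sum mulr_sumr; apply: eq_bigr => h _.
by rewrite MU !gr_actU zautD MU.
Qed.

Lemma gr_act1 u : gr_act u 1 = 1.
Proof. by rewrite [LHS]gr_actU zaut0. Qed.

Definition gr_invariant : {pred group_ring V} :=
  fun x => `[< forall u, gr_act u x = x >].

Lemma gr_invariant_subring : subring_closed gr_invariant.
Proof.
split=> [|x y /asboolP hx /asboolP hy|x y /asboolP hx /asboolP hy].
- by apply/asboolP => u; rewrite gr_act1.
- by apply/asboolP => u; rewrite gr_actD gr_actN hx hy.
- by apply/asboolP => u; rewrite gr_actM hx hy.
Qed.

HB.instance Definition _ :=
  GRing.isSubringClosed.Build (group_ring V) gr_invariant gr_invariant_subring.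

Record invariant_ring := InvariantRing {
  inv_val :> group_ring V; inv_valP : inv_val \in gr_invariant }.

HB.instance Definition _ := [isSub for inv_val].
HB.instance Definition _ := [Choice of invariant_ring by <:].
HB.instance Definition _ := [SubChoice_isSubComNzRing of invariant_ring by <:].

End Invariants.

Definition int_in_rat : zmodClosed rat :=
  GRing.ZmodClosed.clone rat (@Num.int_num_subdef rat) _.

Definition QZ : zmodType := Quotient.quot int_in_rat.

Definition qz (x : rat) : QZ := (\pi_(Quotient.quot int_in_rat) x)%qT.

(* The component of index n lives in Z/(n+1). *)
Record Zhat := ZHat {
  zhat_val :> forall n : nat, 'I_n.+1;
  zhatP : forall m n, (m.+1 %| n.+1)%N -> zhat_val n = zhat_val m %[mod m.+1] }.

Definition Zhat_mul (a b : Zhat) : Zhat.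
Proof.
exists (fun n => Zp_mul (a n) (b n)) => m n dvd /=.
by rewrite modn_dvdm // modn_mod -modnMm (zhatP a dvd) (zhatP b dvd) modnMm.
Defined.

Definition Zhat_one : Zhat.
Proof.
by exists (fun n => inZp 1) => m n dvd /=; rewrite modn_dvdm // modn_mod.
Defined.

Definition Zhat_unit (a : Zhat) := exists b, Zhat_mul a b = Zhat_one.

(* The pointed map fixing 0 and permuting 1, ..., n+1 cyclically. *)
Definition cyclic_shift (n : nat) : pmap (plus n.+1) (plus n.+1) :=
  @PMap (plus n.+1) (plus n.+1)
    (fun i => if i == ord0 then ord0 else inord (i %% n.+1).+1) erefl.

Definition end_cycle (n : nat) : EndC := end_free (finite_plus n.+1) (cyclic_shift n).

(* The canonical map of W_0(S) to Z[Q/Z] records the eigenvalues of an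
   endomorphism, exp(2 i pi q) being written as q in Q/Z: a cyclic permutation
   of n+1 elements goes to the sum of the k/(n+1), 0 <= k <= n. *)
Definition canonical (W : global_Witt_ring) (f : W -> invariant_ring QZ) : Prop :=
  forall n, inv_val (f (witt_class W (end_cycle n)))
            = \sum_(k < n.+1) gr_elt (qz (k%:R / n.+1%:R)).

(* Main.v *)
From HB Require Import structures.
From mathcomp Require Import all_boot all_order all_algebra.
From mathcomp Require Import boolp classical_sets cardinality.
From mathcomp Require Import finmap monalg.
Require Import Defs.

(** An object of the class C is, up to isomorphism, a free module on its pointed
    set at level one, so a pair (E, T) amounts to a finite pointed set X with a
    pointed self-map t ([end_iso_level1]).  If t is not injective, passing to
    the image shrinks X without changing additive invariants; if t is injective,
    X is a wedge of cyclic permutations.  Hence a statement about pairs that is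
    compatible with isomorphisms, images and wedges only has to be checked on
    cyclic permutations and on the one-point set ([EndC_ind]), and an additive invariant is determined by
    its values there.

    On the other side, let N_m be the sum in Z[Q/Z] of all elements killed by m;
    it is the image required of the cycle of length m.  The coefficient of N_m at
    g is 1 if m g = 0 and 0 otherwise, so N_m is invariant.  The N_m with m >= 1
    form a basis of the invariants: automorphisms of Q/Z act transitively on the
    elements of a given order ([zaut_transitive]), so an invariant is determined
    by its coefficients at the points 1/n, and the coefficient of N_m at 1/n is 1
    if n divides m and 0 otherwise, a triangular matrix.  Therefore additive maps
    out of the invariants are the same thing as arbitrary sequences
    ([inv_torsion_sum_extend]).

    The candidate for the universal invariant sends (X, t) to the sum of N_p over
    the cycles of t other than the base point, where p is the length of the
    cycle.  To avoid choosing one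
    point in each cycle it is computed after multiplication by an integer M
    divisible by all the periods: M times it is the sum of (M / p(x)) N_{p(x)}
    over all the points x other than the base point, where p(x) is the period
    ([is_witt]).  This is enough, since Z[Q/Z] is torsion free, and it makes
    invariance and additivity a matter of reindexing sums.  It also gives
    multiplicativity: the period of u /\ v is the least common multiple of the
    periods m and n of u and v, and lcm(m, n) N_m N_n = m n N_{lcm(m, n)}
    ([torsion_sum_mul]).  Universality follows from the basis and from the
    determination by cycles, and any other ring with the universal property is
    identified with this one by comparing universal invariants.

    Finally an automorphism u of Q/Z is described by the integers a_n modulo n
    with u(1/n) = a_n/n.  They form an element of the profinite integers, which is
    a unit because u has an inverse; conversely a unit a acts on an element
    killed by n as multiplication by a_n. *)

Set Implicit Arguments.
Unset Strict Implicit.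
Unset Printing Implicit Defensive.

Import GRing.Theory Num.Theory.
Local Open Scope ring_scope.

(** * Fractions in Q/Z *)

Lemma qz_is_zmod_morphism : zmod_morphism qz.
Proof. exact: (raddfB (\pi_(Quotient.quot int_in_rat)%qT)). Qed.

HB.instance Definition _ := GRing.isZmodMorphism.Build rat QZ qz qz_is_zmod_morphism.

Lemma qz_eq (x y : rat) : (qz x == qz y) = (x - y \is a Num.int).
Proof. exact: (esym (Quotient.idealrBE int_in_rat x y)). Qed.

Lemma qz0 : qz 0 = 0.
Proof. exact: raddf0. Qed.

Lemma qz_eq0 (x : rat) : (qz x == 0) = (x \is a Num.int).
Proof. by have h := qz_eq x 0; rewrite subr0 in h; rewrite -h qz0. Qed.

Lemma qzB (x y : rat) : qz (x - y) = qz x - qz y.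
Proof. exact: (raddfB qz). Qed.

Lemma qzMn (x : rat) n : qz (x *+ n) = qz x *+ n.
Proof. exact: (raddfMn qz). Qed.

Lemma qz_surj (g : QZ) : exists x, g = qz x.
Proof. by exists (repr g); rewrite /qz reprK. Qed.

Definition qfrac (k m : nat) : QZ := qz (k%:R / m%:R).

Lemma qfrac_mulrn k m : qfrac k m = qfrac 1 m *+ k.
Proof. by rewrite /qfrac -qzMn -mulrnAl. Qed.

Lemma qfrac_add k l m : qfrac (k + l) m = qfrac k m + qfrac l m.
Proof. by rewrite (qfrac_mulrn (k + l)) (qfrac_mulrn k) (qfrac_mulrn l) mulrnDr. Qed.

Lemma qfrac_mul k m n : (0 < n)%N -> qfrac (k * n) (m * n) = qfrac k m.
Proof.
move=> n0; rewrite /qfrac !natrM -mulf_div divff ?mulr1 //.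
by rewrite pnatr_eq0 -lt0n.
Qed.

Lemma qfrac_eq0 k m : (0 < m)%N -> (qfrac k m == 0) = (m %| k)%N.
Proof.
move=> m0; have mn0 : m%:R != 0 :> rat by rewrite pnatr_eq0 -lt0n.
rewrite qz_eq0; apply/idP/idP => [|/dvdnP[q ->]]; last first.
  by rewrite natrM mulfK // natr_int.
move=> /intrP[z e].
have {}e : k%:Z = z * m%:Z.
  by apply/eqP; rewrite -(eqr_int rat) rmorphM /= -e divfK.
have : (m%:Z %| k%:Z)%Z by rewrite e dvdz_mull.
by rewrite /dvdz /= .
Qed.

Lemma qfrac_eq k l m : (0 < m)%N -> qfrac k m = qfrac l m <-> k = l %[mod m].
Proof.
move=> m0; wlog le : k l / (l <= k)%N.
  move=> H; case: (leqP l k) => [|/ltnW] le; first exact: H.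
  by split=> /esym/(H _ _ le)/esym.
rewrite -(subnK le) qfrac_add; split=> [/eqP|/eqP].
  rewrite -subr_eq0 addrK qfrac_eq0 // => /dvdnP[q ->].
  by rewrite modnMDl.
rewrite -[X in _ == X %[mod _]]add0n eqn_modDr mod0n -/(dvdn _ _) -qfrac_eq0 // => /eqP ->.
by rewrite add0r.
Qed.

Lemma qfracn m : (0 < m)%N -> qfrac m m = 0.
Proof. by move=> m0; apply/eqP; rewrite qfrac_eq0. Qed.

(** Conversely to [qfracMn], the m-torsion of Q/Z is cyclic, generated by
    1/m: if x is rational and m x = z is an integer, then x is the class of
    (z mod m)/m. *)
Lemma torsion_qfrac (g : QZ) m : (0 < m)%N -> g *+ m = 0 ->
  exists2 k, (k < m)%N & g = qfrac k m.
Proof.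
move=> m0; have [x ->] := qz_surj g.
rewrite -qzMn => /eqP; rewrite qz_eq0 => /intrP[z e].
have mn0 : m%:R != 0 :> rat by rewrite pnatr_eq0 -lt0n.
have m0z : m%:Z != 0 by rewrite eqz_nat -lt0n.
have ex : x = z%:~R / m%:R.
  by apply: (mulIf mn0); rewrite divfK // -e mulr_natr.
(* The remainder of z modulo m is nonnegative, so its absolute value loses
    nothing. *)
exists `|(z %% m%:Z)%Z|%N.
  by rewrite -ltz_nat gez0_abs ?modz_ge0 // (ltz_pmod z (d := m%:Z)).
apply/eqP; rewrite -subr_eq0 /qfrac -qzB qz_eq0 ex -mulrBl -[_%:R]/((_ : nat)%:~R).
by rewrite gez0_abs ?modz_ge0 // {1}(divz_eq z m%:Z) -intrB addrK intrM mulfK.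
Qed.

Lemma qfracMn k m n : (0 < m)%N -> qfrac k m *+ n = qfrac (n * k) m.
Proof. by rewrite mulnC [in RHS]qfrac_mulrn mulrnA -qfrac_mulrn. Qed.

Lemma torsion_ex (g : QZ) : exists2 m, (0 < m)%N & g *+ m = 0.
Proof.
have [x ->] := qz_surj g; exists `|denq x|%N; first by rewrite absz_gt0 denq_neq0.
apply/eqP; rewrite -qzMn qz_eq0 -mulr_natr natr_absz gtr0_norm ?denq_gt0 //.
by rewrite -numqE intr_int.
Qed.

(** * Torsion sums in the group ring *)

Lemma gr_eltM (V : zmodType) (g h : V) : gr_elt g * gr_elt h = gr_elt (g + h).
Proof. by rewrite [LHS]gr_mulUU mulr1. Qed.

Lemma coef_gr_elt (V : zmodType) (g h : V) : (gr_elt g)@_h = (g == h)%:R.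
Proof. by rewrite mcoeffU. Qed.

(** The element N_m of the introduction, the sum of the elements of Q/Z
    killed by m; these are the k/m with k < m by [torsion_qfrac]. For m = 0
    the sum is empty, and this value is used below for points that are not
    periodic. *)
Definition torsion_sum (m : nat) : group_ring QZ := \sum_(k < m) gr_elt (qfrac k m).

Lemma coef_torsion_sum m g : (0 < m)%N -> (torsion_sum m)@_g = (g *+ m == 0)%:R.
Proof.
move=> m0; rewrite /torsion_sum (raddf_sum (mcoeff g)) /=.
under eq_bigr do rewrite coef_gr_elt.
case: eqP => [/(torsion_qfrac m0) [k km ->]|ne].
  rewrite (bigD1 (Ordinal km)) //= eqxx big1 ?addr0 // => i ne.
  case: eqP => // /(qfrac_eq _ _ m0); rewrite !modn_small // => e.
  by case/eqP: ne; apply: val_inj.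
rewrite big1 // => i _; case: eqP => // e; case: ne; rewrite -e qfracMn //.
by apply/eqP; rewrite qfrac_eq0 // dvdn_mulr.
Qed.

Lemma coef_translate (V : zmodType) (g h : V) (x : group_ring V) :
  (gr_elt g * x)@_h = x@_(h - g).
Proof.
have E : x = \sum_(k <- msupp x) (<< x@_k *g k >> : group_ring V) by exact: monalgE.
rewrite {1}E [X in _ = mcoeff _ X]E mulr_sumr !raddf_sum; apply: eq_bigr => k _ /=.
by rewrite [_ * _]gr_mulUU mul1r !mcoeffU (eq_sym k) subr_eq addrC (eq_sym h).
Qed.

Lemma group_ringP (V : zmodType) (x y : group_ring V) : (forall g, x@_g = y@_g) -> x = y.
Proof. by move=> /malgP. Qed.

(** Translation by g permutes the m-torsion as soon as g belongs to it. *)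
Lemma torsion_sum_translate m (g : QZ) : (0 < m)%N -> g *+ m = 0 ->
  gr_elt g * torsion_sum m = torsion_sum m.
Proof.
move=> m0 e; apply: group_ringP => h.
by rewrite coef_translate !coef_torsion_sum // mulrnBl e subr0.
Qed.

(** The subgroup killed by lcm(m, n) is the sum of those killed by m and by
    n. With d = gcd(m, n) = u m - v n and L = lcm(m, n), division of the
    Bezout relation by d writes 1 = u m/d - v n/d; multiply k/L by it and use
    L = (n/d) m = (m/d) n. *)
Lemma torsion_lcm m n (g : QZ) : (0 < m)%N -> (0 < n)%N -> g *+ lcmn m n = 0 ->
  exists a b, [/\ g = a + b, a *+ m = 0 & b *+ n = 0].
Proof.
move=> m0 n0; set L := lcmn m n; have L0 : (0 < L)%N by rewrite lcmn_gt0 m0.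
move=> /(torsion_qfrac L0) [k _ ->].
have [u v e _] := egcdnP n m0.
have d0 : (0 < gcdn m n)%N by rewrite gcdn_gt0 m0.
have LE : (L * gcdn m n = m * n)%N by exact: muln_lcm_gcd.
have [m' mE] : exists m', m = (m' * gcdn m n)%N by apply/dvdnP/dvdn_gcdl.
have [n' nE] : exists n', n = (n' * gcdn m n)%N by apply/dvdnP/dvdn_gcdr.
set d := gcdn m n in e d0 LE mE nE.
have Ln : L = (m' * n)%N.
  by apply/eqP; rewrite -(eqn_pmul2r d0) LE {1}mE mulnAC.
have Lm : L = (n' * m)%N.
  by apply/eqP; rewrite -(eqn_pmul2r d0) LE {1}nE mulnCA mulnA mulnAC.
have uv : (u * m' = v * n' + 1)%N.
  by apply/eqP; rewrite -(eqn_pmul2r d0) mulnDl -!mulnA -mE -nE mul1n e.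
(* The first term is killed by m because n' m = L, the second by n because m'
    n = L. *)
exists (- qfrac (k * v * n') L), (qfrac (k * u * m') L); split.
- by rewrite -(mulnA k u) uv mulnDr muln1 mulnA qfrac_add addKr.
- rewrite mulNrn qfracMn //; apply/eqP; rewrite oppr_eq0 qfrac_eq0 //.
  by rewrite {1}Lm [X in (_ %| X)%N]mulnC -mulnA dvdn_mull.
- rewrite qfracMn //; apply/eqP; rewrite qfrac_eq0 //.
  by rewrite {1}Ln [X in (_ %| X)%N]mulnC -mulnA dvdn_mull.
Qed.

Lemma torsion_sum_mul_divisor m n : (0 < n)%N -> (m %| n)%N ->
  torsion_sum m * torsion_sum n = torsion_sum n *+ m.
Proof.
move=> n0 mn; rewrite {1}/torsion_sum mulr_suml -[m in RHS]card_ord -sumr_const.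
apply: eq_bigr => k _; apply: torsion_sum_translate => //.
have m0 : (0 < m)%N by exact: dvdn_gt0 mn.
by apply/eqP; rewrite qfracMn // qfrac_eq0 // dvdn_mulr.
Qed.

Lemma mulrn_group_ring_inj (V : zmodType) n (x y : group_ring V) :
  (0 < n)%N -> x *+ n = y *+ n -> x = y.
Proof.
move=> n0 e; apply: group_ringP => g; have := congr1 (mcoeff g) e.
by rewrite !(raddfMn (mcoeff g)) => /eqP; rewrite eqr_pMn2r // => /eqP.
Qed.

(** Both sides equal N_L N_m N_n, where L = lcm(m, n). Expanding N_L, each of
    its L terms is a product of an m-torsion and an n-torsion translation
    ([torsion_lcm]), hence fixes N_m N_n; absorbing N_m and N_n into N_L
    instead contributes the factor m n. *)
Lemma torsion_sum_mul m n :
  torsion_sum m * torsion_sum n *+ lcmn m n = torsion_sum (lcmn m n) *+ (m * n).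
Proof.
have [->|m0] := posnP m; first by rewrite lcm0n.
have [->|n0] := posnP n; first by rewrite lcmn0 muln0.
set L := lcmn m n; have L0 : (0 < L)%N by rewrite lcmn_gt0 m0.
transitivity (torsion_sum L * (torsion_sum m * torsion_sum n)); last first.
  rewrite mulrCA [torsion_sum L * _]mulrC torsion_sum_mul_divisor ?dvdn_lcmr //.
  by rewrite mulrnAr torsion_sum_mul_divisor ?dvdn_lcml // -mulrnA.
transitivity (\sum_(k < L) gr_elt (qfrac k L) * (torsion_sum m * torsion_sum n)); last by rewrite -mulr_suml.
rewrite -[in LHS](card_ord L) -sumr_const; apply: eq_bigr => k _.
have [|a [b [-> ea eb]]] := @torsion_lcm m n (qfrac k L) m0 n0.
  by apply/eqP; rewrite qfracMn // qfrac_eq0 // dvdn_mulr.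
by rewrite -gr_eltM mulrACA !torsion_sum_translate.
Qed.

(** * Torsion sums are invariant *)

Lemma zaut_inj (V : zmodType) (u : zaut V) : injective u.
Proof. exact: bij_inj (zaut_bij u). Qed.

Lemma zautMn (V : zmodType) (u : zaut V) g n : u (g *+ n) = u g *+ n.
Proof. by elim: n => [|n IH]; rewrite ?mulr0n ?zaut0 // !mulrSr zautD IH. Qed.

Lemma coef_gr_act (V : zmodType) (u : zaut V) (x : group_ring V) g :
  (gr_act u x)@_(u g) = x@_g.
Proof.
rewrite {2}[x]monalgE /gr_act !raddf_sum; apply: eq_bigr => k _ /=.
by rewrite !mcoeffU (inj_eq (@zaut_inj _ u)).
Qed.

(** The action of u moves the coefficient at g to u g, so invariance means
    that coefficients are constant on orbits. *)
Lemma gr_invariantP (V : zmodType) (x : group_ring V) :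
  reflect (forall (u : zaut V) g, x@_(u g) = x@_g) (x \in @gr_invariant V).
Proof.
apply: (iffP (asboolP _)) => h u; first by move=> g; rewrite -{1}(h u) coef_gr_act.
apply: group_ringP => g; have [v _ uv] := zaut_bij u.
by rewrite -[g]uv coef_gr_act h.
Qed.

Lemma torsion_sum_invariant m : torsion_sum m \in @gr_invariant QZ.
Proof.
apply/gr_invariantP => u g; have [->|m0] := posnP m.
  by rewrite /torsion_sum big_ord0 !mcoeff0.
by rewrite !coef_torsion_sum // -zautMn -{1}(zaut0 u) (inj_eq (@zaut_inj _ u)).
Qed.

Definition inv_torsion_sum m : invariant_ring QZ := InvariantRing (torsion_sum_invariant m).

Lemma inv_val_inj (V : zmodType) : injective (@inv_val V).
Proof. exact: val_inj. Qed.

Lemma inv_valB (V : zmodType) (x y : invariant_ring V) :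
  inv_val (x - y) = inv_val x - inv_val y.
Proof. exact: (raddfB (val : invariant_ring V -> group_ring V)). Qed.

HB.instance Definition _ (V : zmodType) :=
  GRing.isZmodMorphism.Build (invariant_ring V) (group_ring V) (@inv_val V) (@inv_valB V).

Lemma inv_valMn (V : zmodType) (x : invariant_ring V) n :
  inv_val (x *+ n) = inv_val x *+ n.
Proof. exact: (raddfMn (@inv_val V)). Qed.

Lemma inv_valM (V : zmodType) (x y : invariant_ring V) :
  inv_val (x * y) = inv_val x * inv_val y.
Proof. by []. Qed.

Lemma inv_torsion_sum_mul m n :
  inv_torsion_sum m * inv_torsion_sum n *+ lcmn m n
  = inv_torsion_sum (lcmn m n) *+ (m * n).
Proof. by apply: inv_val_inj; rewrite !inv_valMn inv_valM; apply: torsion_sum_mul. Qed.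

Lemma mulrn_invariant_inj (V : zmodType) n (x y : invariant_ring V) :
  (0 < n)%N -> x *+ n = y *+ n -> x = y.
Proof.
move=> n0 /(congr1 (@inv_val V)); rewrite !inv_valMn => /(mulrn_group_ring_inj n0).
exact: inv_val_inj.
Qed.

(** * Automorphisms of Q/Z and the units of the profinite integers *)

Lemma Zhat_eq (a b : Zhat) : (forall n, zhat_val a n = zhat_val b n) -> a = b.
Proof.
case: a b => [a ha] [b hb] /= e.
have {}e : a = b by apply: functional_extensionality_dep.
by subst b; congr ZHat; exact: Prop_irrelevance.
Qed.

Lemma zaut_eq (V : zmodType) (u v : zaut V) : u =1 v -> u = v.
Proof.
case: u v => [u du bu] [v dv bv] /= /funext e; subst v.
by congr ZAut; exact: Prop_irrelevance.
Qed.

(** An automorphism preserves the (n+1)-torsion, which is generated by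
    1/(n+1). *)
Lemma zaut_qfrac_ex (u : zaut QZ) n : exists k : 'I_n.+1, u (qfrac 1 n.+1) = qfrac k n.+1.
Proof.
have [|k kn e] := @torsion_qfrac (u (qfrac 1 n.+1)) n.+1 (ltn0Sn n); last by exists (Ordinal kn).
by rewrite -zautMn -qfrac_mulrn qfracn // zaut0.
Qed.

Definition zaut_val (u : zaut QZ) n : 'I_n.+1 := sval (cid (zaut_qfrac_ex u n)).

Lemma zaut_valE (u : zaut QZ) n : u (qfrac 1 n.+1) = qfrac (zaut_val u n) n.+1.
Proof. exact: svalP (cid (zaut_qfrac_ex u n)). Qed.

(** If n + 1 = (q + 1)(m + 1), then 1/(m + 1) is q + 1 times 1/(n + 1), and u
    commutes with this multiplication. *)
Lemma zaut_val_coherent (u : zaut QZ) m n : (m.+1 %| n.+1)%N ->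
  zaut_val u n = zaut_val u m %[mod m.+1].
Proof.
move=> /dvdnP[[//|q] e]; apply/(qfrac_eq _ _ (ltn0Sn m)); rewrite -zaut_valE.
have E k : qfrac k m.+1 = qfrac (k * q.+1) n.+1 by rewrite e [(q.+1 * _)%N]mulnC qfrac_mul.
by rewrite !E mul1n [qfrac q.+1 _]qfrac_mulrn zautMn zaut_valE qfracMn // mulnC.
Qed.

Definition zaut_zhat (u : zaut QZ) : Zhat := ZHat (zaut_val_coherent u).

Lemma zaut_val_eq (u : zaut QZ) n k : u (qfrac 1 n.+1) = qfrac k n.+1 ->
  zaut_val u n = (k %% n.+1)%N :> nat.
Proof.
rewrite zaut_valE => /(qfrac_eq _ _ (ltn0Sn n)) <-; by rewrite modn_small.
Qed.

Lemma zaut_determined (u v : zaut QZ) :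
  (forall n, u (qfrac 1 n.+1) = v (qfrac 1 n.+1)) -> u = v.
Proof.
move=> e; apply: zaut_eq => g; have [[//|m] m0 /(torsion_qfrac m0) [k _ ->]] := torsion_ex g.
by rewrite qfrac_mulrn !zautMn e.
Qed.

Lemma zaut_zhat_inj : injective zaut_zhat.
Proof.
move=> u v e; apply: zaut_determined => n; rewrite !zaut_valE.
by rewrite (congr1 (fun a : Zhat => zhat_val a n) e : zaut_val u n = zaut_val v n).
Qed.

Lemma zaut_zhat_comp u v : zaut_zhat (zaut_comp u v) = Zhat_mul (zaut_zhat u) (zaut_zhat v).
Proof.
apply: Zhat_eq => n; apply: val_inj => /=; apply: zaut_val_eq.
by rewrite /= zaut_valE qfrac_mulrn zautMn zaut_valE qfracMn // mulnC.
Qed.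

Definition zaut_id (V : zmodType) : zaut V.
Proof. by exists id => //; exists id. Defined.

Lemma zaut_zhat_id : zaut_zhat (zaut_id QZ) = Zhat_one.
Proof. by apply: Zhat_eq => n; apply: val_inj; apply: zaut_val_eq. Qed.

Lemma zaut_inv_ex (V : zmodType) (u : zaut V) : exists v, zaut_comp u v = zaut_id V.
Proof.
have [v vu uv] := zaut_bij u.
have vD : {morph v : x y / x + y}.
  by move=> x y; apply: (can_inj vu); rewrite zautD !uv.
have vb : bijective v by exists u.
by exists (ZAut vD vb); apply: zaut_eq => x /=; rewrite uv.
Qed.

Lemma zaut_zhat_unit u : Zhat_unit (zaut_zhat u).
Proof.
have [v e] := zaut_inv_ex u; exists (zaut_zhat v).
by rewrite -zaut_zhat_comp e zaut_zhat_id.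
Qed.

(** Some n such that n + 1 kills g. *)
Definition torsion_exp (g : QZ) : nat := (sval (cid2 (torsion_ex g))).-1.

Lemma torsion_exp_torsion g : g *+ (torsion_exp g).+1 = 0.
Proof. by rewrite /torsion_exp; case: cid2 => -[|m]. Qed.

(** Multiplication of g by a profinite integer a, which only involves a
    modulo an integer that kills g; [zhat_actE] says that any such integer
    gives the same result. *)
Definition zhat_act (a : Zhat) (g : QZ) : QZ := g *+ zhat_val a (torsion_exp g).

Lemma mulrn_mod (g : QZ) m k l : g *+ m = 0 -> k = l %[mod m] -> g *+ k = g *+ l.
Proof.
move=> e kl; rewrite (divn_eq k m) (divn_eq l m) kl !mulrnDr.
by rewrite ![(_ * m)%N]mulnC !mulrnA e !mul0rn.
Qed.

(** Compare both multiples with the one read modulo the product of the two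
    annihilating integers, using the coherence of a. *)
Lemma zhat_actE a g n : g *+ n.+1 = 0 -> zhat_act a g = g *+ zhat_val a n.
Proof.
move=> e; set N := (n.+1 * (torsion_exp g).+1).-1.
have NE : N.+1 = (n.+1 * (torsion_exp g).+1)%N by [].
transitivity (g *+ zhat_val a N).
  by apply: (mulrn_mod (torsion_exp_torsion g)); rewrite (@zhatP a (torsion_exp g) N) // NE dvdn_mull.
by apply: (mulrn_mod e); rewrite (@zhatP a n N) // NE dvdn_mulr.
Qed.

Lemma zhat_actD a : {morph zhat_act a : g h / g + h}.
Proof.
move=> g h; set N := ((torsion_exp g).+1 * (torsion_exp h).+1).-1.
have NE : N.+1 = ((torsion_exp g).+1 * (torsion_exp h).+1)%N by [].
have eg : g *+ N.+1 = 0 by rewrite NE mulrnA torsion_exp_torsion mul0rn.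
have eh : h *+ N.+1 = 0 by rewrite NE mulnC mulrnA torsion_exp_torsion mul0rn.
rewrite (zhat_actE a eg) (zhat_actE a eh) -mulrnDl; apply: zhat_actE.
by rewrite mulrnDl eg eh addr0.
Qed.

Lemma zhat_actM a b g : zhat_act (Zhat_mul a b) g = zhat_act a (zhat_act b g).
Proof.
have e := torsion_exp_torsion g; set n := torsion_exp g in e.
rewrite !(zhat_actE _ e) (@zhat_actE a _ n); last by rewrite -mulrnA mulnC mulrnA e mul0rn.
by rewrite -mulrnA; apply: (mulrn_mod e); rewrite /= modn_mod mulnC.
Qed.

Lemma zhat_act1 g : zhat_act Zhat_one g = g.
Proof.
rewrite /zhat_act -[RHS]mulr1n.
by apply: (mulrn_mod (torsion_exp_torsion g)); rewrite /= modn_mod.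
Qed.

Lemma Zhat_mulC a b : Zhat_mul a b = Zhat_mul b a.
Proof. by apply: Zhat_eq => n; apply: val_inj; rewrite /= mulnC. Qed.

Lemma zhat_unit_zaut a : Zhat_unit a -> exists u : zaut QZ, u =1 zhat_act a.
Proof.
case=> b ab; have bij : bijective (zhat_act a).
  by exists (zhat_act b) => g; rewrite -zhat_actM ?ab ?[Zhat_mul b a]Zhat_mulC ?ab zhat_act1.
by exists (ZAut (zhat_actD a) bij).
Qed.

Lemma zhat_act_qfrac a n : zhat_act a (qfrac 1 n.+1) = qfrac (zhat_val a n) n.+1.
Proof. by rewrite (@zhat_actE a _ n) -?qfrac_mulrn // qfracn. Qed.

Lemma Zhat_unitP (a : Zhat) : Zhat_unit a <-> exists u, zaut_zhat u = a.
Proof.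
split=> [/zhat_unit_zaut [u ua]|[u <-]]; last exact: zaut_zhat_unit.
exists u; apply: Zhat_eq => n; apply: val_inj => /=.
by rewrite (@zaut_val_eq u n (zhat_val a n)) ?modn_small // ua zhat_act_qfrac.
Qed.

(** * Automorphisms act transitively on the elements of a given order *)

(** A number congruent to k modulo the part of n supported on the primes that
    divide d, and to 1 modulo the remaining part. As n varies these numbers
    form the profinite integer whose p-adic component is k if p divides d and
    1 otherwise. *)
Definition crt_seq (d k n : nat) : nat := chinese n`_(\pi(d)) n`_(\pi(d)^') k 1.

Lemma crt_seq_coherent d k m n : (0 < n)%N -> (m %| n)%N ->
  crt_seq d k n = crt_seq d k m %[mod m].
Proof.
move=> n0 mn; have m0 : (0 < m)%N := dvdn_gt0 n0 mn.
have co (x : nat) : coprime x`_(\pi(d)) x`_(\pi(d)^') by exact: coprime_partC.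
have dv pi : (m`_pi %| n`_pi)%N by exact: partn_dvd.
rewrite -{1 3}(partnC \pi(d) m0); apply/eqP; rewrite chinese_remainder //.
rewrite /crt_seq; apply/andP; split; apply/eqP.
  by rewrite -(modn_dvdm _ (dv _)) !chinese_modl // modn_dvdm.
by rewrite -(modn_dvdm _ (dv _)) !chinese_modr // modn_dvdm.
Qed.

Definition crt_zhat (d k : nat) : Zhat.
Proof.
exists (fun n => inZp (crt_seq d k n.+1)) => m n mn /=.
by rewrite modn_dvdm // modn_mod; apply: crt_seq_coherent.
Defined.

Lemma inverse_mod a n : (0 < n)%N -> coprime a n ->
  exists2 b, (b < n)%N & a * b = 1 %[mod n].
Proof.
move=> n0; have [-> co|a0 co] := posnP a.
  by exists 0%N => //; move: co; rewrite /coprime gcd0n => /eqP ->; rewrite !modn1.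
have [u v e _] := egcdnP n a0; exists (u %% n)%N; first by rewrite ltn_mod.
by rewrite modnMmr mulnC e (eqP co) modnMDl.
Qed.

Lemma inverse_mod_unique m a a' b b' : a = a' %[mod m] ->
  a * b = 1 %[mod m] -> a' * b' = 1 %[mod m] -> b = b' %[mod m].
Proof.
move=> aa ab ab'.
have h1 : b = a' * b' * b %[mod m] by rewrite -modnMml ab' modnMml mul1n.
have h2 : b' = a * b * b' %[mod m] by rewrite -modnMml ab modnMml mul1n.
by rewrite h1 h2 -mulnA -modnMml -aa modnMml mulnA mulnAC.
Qed.

(** The inverses modulo each integer assemble into a profinite integer
    because an inverse is unique modulo each divisor. *)
Lemma Zhat_unit_coprime (a : Zhat) :
  (forall n, coprime (zhat_val a n) n.+1) -> Zhat_unit a.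
Proof.
move=> co; have ex n : exists b : 'I_n.+1, zhat_val a n * b = 1 %[mod n.+1].
  by have [b bn e] := inverse_mod (ltn0Sn n) (co n); exists (Ordinal bn).
pose b n := sval (cid (ex n)).
have bP n : zhat_val a n * b n = 1 %[mod n.+1] := svalP (cid (ex n)).
have bc m n : (m.+1 %| n.+1)%N -> b n = b m %[mod m.+1].
  move=> mn; apply: (inverse_mod_unique (zhatP a mn)) (bP m).
  by rewrite -(modn_dvdm _ mn) bP modn_dvdm.
by exists (ZHat bc); apply: Zhat_eq => n; apply: val_inj; rewrite /= bP.
Qed.

(** The local components are k at the primes dividing d, to which k is
    coprime, and 1 elsewhere. *)
Lemma crt_zhat_unit d k : (0 < d)%N -> coprime k d -> Zhat_unit (crt_zhat d k).
Proof.
move=> d0 co; apply: Zhat_unit_coprime => n /=; rewrite coprime_modl.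
have co' : coprime (n.+1)`_\pi(d) (n.+1)`_\pi(d)^' by exact: coprime_partC.
rewrite -{2}(partnC \pi(d) (ltn0Sn n)) coprimeMr.
rewrite -coprime_modl chinese_modl // coprime_modl.
rewrite -[X in _ && X]coprime_modl chinese_modr // coprime_modl coprime1n andbT.
have [k0|k0] := posnP k.
  (* For k = 0 coprimality forces d = 1, and the part supported on the primes
      of d is empty. *)
  by move: co; rewrite k0 /coprime gcd0n => /eqP ->; rewrite /partn big_pred0.
rewrite coprime_sym; apply: (@pnat_coprime \pi(d)); first exact: part_pnat.
by rewrite -coprime_pi' // coprime_sym.
Qed.

Lemma crt_seq_self d k : (0 < d)%N -> crt_seq d k d = k %[mod d].
Proof.
move=> d0; have := chinese_modl (coprime_partC \pi(d) d d) k 1.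
by rewrite -/(crt_seq d k d) (part_pnat_id (pnat_pi d0)).
Qed.

(** This is the transitivity of the automorphism group on the elements of
    order m; the point is to lift the unit k modulo m to a unit of the
    profinite integers. *)
Lemma zaut_transitive m k : (0 < m)%N -> coprime k m ->
  exists u : zaut QZ, u (qfrac 1 m) = qfrac k m.
Proof.
case: m => // m _ co; have [u e] := zhat_unit_zaut (crt_zhat_unit (ltn0Sn m) co).
exists u; rewrite e zhat_act_qfrac; apply/qfrac_eq => //=.
by rewrite modn_mod crt_seq_self.
Qed.

Lemma reduced_qfrac (g : QZ) : exists m k, [/\ (0 < m)%N, coprime k m & g = qfrac k m].
Proof.
have [m m0 /(torsion_qfrac m0)[k _ ->]] := torsion_ex g.
have d0 : (0 < gcdn k m)%N by rewrite gcdn_gt0 m0 orbT.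
exists (m %/ gcdn k m)%N, (k %/ gcdn k m)%N; split.
- by rewrite divn_gt0 // dvdn_leq // dvdn_gcdr.
- by rewrite /coprime -(eqn_pmul2r d0) muln_gcdl !divnK ?dvdn_gcdl ?dvdn_gcdr // mul1n.
- by rewrite -[RHS](qfrac_mul _ _ d0) !divnK ?dvdn_gcdl ?dvdn_gcdr.
Qed.

(** Every element of Q/Z is the image of some 1/m under an automorphism. *)
Lemma invariant_eq (x y : invariant_ring QZ) :
  (forall m, (0 < m)%N -> (inv_val x)@_(qfrac 1 m) = (inv_val y)@_(qfrac 1 m)) -> x = y.
Proof.
move=> e; apply: inv_val_inj; apply: group_ringP => g.
have [m [k [m0 co ->]]] := reduced_qfrac g.
have [u <-] := zaut_transitive m0 co.
have /gr_invariantP -> := inv_valP x; have /gr_invariantP -> := inv_valP y.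
exact: e.
Qed.

(** * Torsion sums form a basis of the invariants *)

Section FreeAbelian.
Variables (A : zmodType) (v : nat -> A).

(** The additive extension of v to the free abelian group on the natural
    numbers. *)
Definition free_lift (z : {malg int[nat]}) : A := \sum_(n <- msupp z) v n *~ z@_n.

Lemma free_liftw (d : {fset nat}) z : (msupp z `<=` d)%fset ->
  free_lift z = \sum_(n <- d) v n *~ z@_n.
Proof.
by move=> le; rewrite /free_lift (big_fset_incl _ le) //= => n _ /mcoeff_outdom ->.
Qed.

Lemma free_lift_is_zmod_morphism : zmod_morphism free_lift.
Proof.
move=> x y; rewrite (free_liftw (msuppB_le _ _)) (free_liftw (fsubsetUl _ (msupp y))).
rewrite (free_liftw (fsubsetUr (msupp x) _)) -sumrB.
by apply: eq_bigr => n _; rewrite mcoeffB mulrzBr.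
Qed.

HB.instance Definition _ :=
  GRing.isZmodMorphism.Build {malg int[nat]} A free_lift free_lift_is_zmod_morphism.

Lemma free_liftU n c : free_lift << c *g n >> = v n *~ c.
Proof. by rewrite (free_liftw msuppU_le) big_seq_fset1 mcoeffUU. Qed.

End FreeAbelian.

(** The triangular matrix on which the basis property rests. *)
Lemma coef_torsion_inv m n : (0 < m)%N -> (0 < n)%N ->
  (torsion_sum m)@_(qfrac 1 n) = (n %| m)%:R.
Proof. by move=> m0 n0; rewrite coef_torsion_sum // qfracMn // muln1 qfrac_eq0. Qed.

(** The index n stands for N_(n+1), so that N_0 = 0 is left out. *)
Definition torsion_sum_comb : {malg int[nat]} -> invariant_ring QZ :=
  free_lift (fun n => inv_torsion_sum n.+1).

Lemma coef_torsion_comb z g :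
  (inv_val (torsion_sum_comb z))@_g = \sum_(n <- msupp z) (torsion_sum n.+1)@_g * z@_n.
Proof.
rewrite /torsion_sum_comb /free_lift.
rewrite (raddf_sum (@inv_val QZ)) (raddf_sum (mcoeff g)).
apply: eq_bigr => n _; rewrite /= (raddfMz (@inv_val QZ)).
by rewrite (raddfMz (mcoeff g)) /= mulrzz.
Qed.

(** If N is the largest index in the support of z, only that index
    contributes to the coefficient at 1/(N + 1). *)
Lemma torsion_sum_comb_inj : injective torsion_sum_comb.
Proof.
suff inj z : torsion_sum_comb z = 0 -> z = 0.
  move=> x y e; apply/eqP; rewrite -subr_eq0; apply/eqP/inj.
  by rewrite /torsion_sum_comb raddfB /= -/(torsion_sum_comb x) e subrr.
move=> z0; apply/eqP/contraT => zn0.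
have ex : exists n, n \in msupp z.
  have [e|[n nz]] := fset_0Vmem (msupp z); last by exists n.
  by case/eqP: zn0; apply/malgP => n; rewrite mcoeff0 mcoeff_outdom // e inE.
have bd n : n \in msupp z -> (n <= \max_(i <- msupp z) i)%N.
  by move=> nz; apply: leq_bigmax_seq.
case: (ex_maxnP ex bd) => N Nz max.
have := coef_torsion_comb z (qfrac 1 N.+1); rewrite z0 mcoeff0 (big_fsetD1 N) //=.
rewrite coef_torsion_inv // dvdnn mul1r big1_fset ?addr0 => [/esym/eqP|n].
  by rewrite mcoeff_eq0 Nz.
rewrite !inE => /andP[nN nz] _; rewrite coef_torsion_inv // gtnNdvd ?mul0r //.
by rewrite ltnS ltn_neqAle nN max.
Qed.

Lemma common_torsion (s : seq QZ) : exists2 M, (0 < M)%N & forall g, g \in s -> g *+ M = 0.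
Proof.
elim: s => [|g s [M M0 sM]]; first by exists 1%N.
have [m m0 e] := torsion_ex g; exists (m * M)%N; first by rewrite muln_gt0 m0.
move=> h; rewrite inE => /predU1P[->|/sM e']; first by rewrite mulrnA e mul0rn.
by rewrite mulnC mulrnA e' mul0rn.
Qed.

(** An invariant has finite support, so its coefficient at 1/m vanishes for m
    larger than some M. Subtracting the multiple of N_M given by the
    coefficient at 1/M lowers this bound, and an invariant with bound 0 is
    zero by [invariant_eq]. *)
Lemma torsion_sum_comb_surj x : exists z, x = torsion_sum_comb z.
Proof.
(* A common annihilator of the support bounds the m for which 1/m lies in it. *)
have [M M0 sM] := common_torsion (msupp (inv_val x)).
have bd m : (M < m)%N -> (inv_val x)@_(qfrac 1 m) = 0.
  move=> Mm; apply: mcoeff_outdom; apply/negP => /sM/eqP.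
  rewrite qfracMn ?(leq_trans _ Mm) // muln1 qfrac_eq0 ?(leq_trans _ Mm) //.
  by rewrite gtnNdvd.
elim: M x bd {M0 sM} => [|M IH] x bd.
  exists 0; rewrite /torsion_sum_comb raddf0; apply: invariant_eq => m m0.
  by rewrite bd // mcoeff0.
set c := (inv_val x)@_(qfrac 1 M.+1).
have [|z e] := IH (x - inv_torsion_sum M.+1 *~ c); last first.
  exists (z + << c *g M >>); rewrite /torsion_sum_comb raddfD /= -/(torsion_sum_comb z) -e.
  by rewrite free_liftU subrK.
move=> m Mm; rewrite inv_valB mcoeffB (raddfMz (@inv_val QZ)) (raddfMz (mcoeff _)) /=.
rewrite coef_torsion_inv ?(leq_trans _ Mm) // mulrzz.
have [->|ne] := eqVneq m M.+1; first by rewrite dvdnn mul1r subrr.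
have Mm' : (M.+1 < m)%N by rewrite ltn_neqAle eq_sym ne.
by rewrite bd // gtnNdvd // mul0r subr0.
Qed.

Lemma torsion_sum_comb_bij : bijective torsion_sum_comb.
Proof.
pose g x := sval (cid (torsion_sum_comb_surj x)).
have gK x : torsion_sum_comb (g x) = x by rewrite -(svalP (cid (torsion_sum_comb_surj x))).
by exists g => // z; apply: torsion_sum_comb_inj; rewrite gK.
Qed.

(** The N_m with m > 0 are free generators of the additive group of
    invariants. *)
Lemma inv_torsion_sum_extend (A : zmodType) (v : nat -> A) :
  exists h : {additive invariant_ring QZ -> A}, forall n, h (inv_torsion_sum n.+1) = v n.
Proof.
have [g gK Kg] := torsion_sum_comb_bij.
have gD : zmod_morphism (free_lift v \o g).
  move=> x y; rewrite -[RHS](raddfB (free_lift v)); congr free_lift.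
  by apply: torsion_sum_comb_inj; rewrite Kg /torsion_sum_comb raddfB /= -!/(torsion_sum_comb _) !Kg.
pose H := GRing.isZmodMorphism.Build (invariant_ring QZ) A (free_lift v \o g) gD.
pose h : {additive invariant_ring QZ -> A} := HB.pack (free_lift v \o g) H.
exists h => n; rewrite /= (_ : inv_torsion_sum n.+1 = torsion_sum_comb << n >>).
  by rewrite gK free_liftU.
by rewrite /torsion_sum_comb free_liftU.
Qed.

Lemma inv_torsion_sum_additive_eq (A : zmodType) (h h' : {additive invariant_ring QZ -> A}) :
  (forall n, h (inv_torsion_sum n.+1) = h' (inv_torsion_sum n.+1)) -> h =1 h'.
Proof.
move=> e x; have [z ->] := torsion_sum_comb_surj x.
by rewrite /torsion_sum_comb /free_lift !raddf_sum; apply: eq_bigr => n _; rewrite !raddfMz e.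
Qed.

(** * Endomorphisms are determined by their level one *)

Lemma inj_surj_bij (T S : Type) (f : T -> S) :
  injective f -> (forall y, exists x, f x = y) -> bijective f.
Proof.
move=> fi fs; pose g y := sval (cid (fs y)).
have gK y : f (g y) = y := svalP (cid (fs y)).
by exists g => // x; apply: fi; rewrite gK.
Qed.

Lemma pmap_inv (X Y : pset) (e : pmap X Y) : bijective e ->
  exists e' : pmap Y X, cancel e e' /\ cancel e' e.
Proof.
case=> e' ee' e'e; have e0 : e' base = base by rewrite -(ee' base) pmapP.
by exists (PMap e0).
Qed.

Lemma shom_bij_inv (E E' : Smod) (f : Shom E E') : (forall k, bijective (f k)) ->
  exists g : Shom E' E, mutually_inverse f g.
Proof.
move=> fb; pose g k := sval (cid (pmap_inv (fb k))).
have [gK Kg] : (forall k, cancel (f k) (g k)) /\ (forall k, cancel (g k) (f k)).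
  by split=> k; have [] := svalP (cid (pmap_inv (fb k))).
have gN k l (h : pmap (plus k) (plus l)) x : g l (smod_map E' h x) = smod_map E h (g k x).
  by apply: (can_inj (gK l)); rewrite Kg shom_nat Kg.
by exists (SHom gN).
Qed.

Definition shom_comp (E E' E'' : Smod) (g : Shom E' E'') (f : Shom E E') : Shom E E''.
Proof. by exists (fun k => pcomp (g k) (f k)) => k l h x; rewrite /= !shom_nat. Defined.

Lemma from_free_bij (E : Smod) : classC E -> forall k, bijective (from_free E k).
Proof.
move=> /classC_free_fin [finE sp fr] k; apply: inj_surj_bij.
  move=> s s'; have [c [u ->]] := psmashP s; have [c' [u' ->]] := psmashP s'.
  rewrite !from_freeE => /fr [[-> ->]//|[h h']].
  by rewrite !smash_in_axes.
by move=> y; have [c [u ->]] := sp k y; exists (smash_in c u); exact: from_freeE.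
Qed.

Lemma from_free_natural (E : Smod) (T : Shom E E) k s :
  from_free E k (free_hom (T 1) k s) = T k (from_free E k s).
Proof.
have [c [u ->]] := psmashP s.
by rewrite [free_hom _ _ _]psmash_mapE !from_freeE shom_nat.
Qed.

Lemma free_hom_bij (F G : pset) (e : pmap F G) k : bijective e -> bijective (free_hom e k).
Proof.
move=> /pmap_inv [e' [ee' e'e]]; exists (free_hom e' k) => s; have [c [u ->]] := psmashP s.
  by rewrite [free_hom e k _]psmash_mapE [LHS]psmash_mapE /= ee'.
by rewrite [free_hom e' k _]psmash_mapE [LHS]psmash_mapE /= e'e.
Qed.

(** Naturality identifies (E, T) with the free module on E(1_+) and the map
    induced by the level-one component of T ([from_free_natural]), so an
    isomorphism at level one extends to all levels. *)
Lemma end_iso_level1 (P Q : EndC) (e : pmap (P 1) (Q 1)) : bijective e ->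
  (forall x, e (end_map P 1 x) = end_map Q 1 (e x)) -> end_iso P Q.
Proof.
move=> eb eT; have [G [KG GK]] := shom_bij_inv (from_free_bij (end_class P)).
pose f := shom_comp (from_free Q) (shom_comp (free_hom e) G).
have fb k : bijective (f k).
  apply: (bij_comp (from_free_bij (end_class Q) k)).
  apply: (bij_comp (free_hom_bij k eb)).
  by exists (from_free P k).
have [g fg] := shom_bij_inv fb; exists f, g; split=> // k x.
have [s ->] : exists s, x = from_free P k s by exists (G k x); rewrite GK.
have fE y : f k (from_free P k y) = from_free Q k (free_hom e k y).
  by rewrite -{2}(KG k y).
rewrite -from_free_natural !fE -from_free_natural; congr (from_free Q k _).
have [c [u ->]] := psmashP s.
rewrite [free_hom (end_map P 1) _ _]psmash_mapE [free_hom e _ _]psmash_mapE.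
by rewrite [free_hom e _ _]psmash_mapE [RHS]psmash_mapE /= eT.
Qed.

Lemma unfree_compat (F : pset) (p q : plus 1 * F) : smash_rel p q ->
  (if p.1 == ord0 then base else p.2) = (if q.1 == ord0 then base else q.2) :> F.
Proof.
have z (r : plus 1 * F) : on_axes r -> (if r.1 == ord0 then base else r.2) = base.
  by case=> ->; rewrite ?eqxx //; case: ifP.
by case=> /z -> /z ->.
Qed.

(** The level one of the free module on F is F itself. *)
Definition unfree (F : pset) : pmap (psmash (plus 1) F) F.
Proof.
exists (quot_lift (fun p => if p.1 == ord0 then base else p.2)).
by rewrite quot_liftE //; exact: unfree_compat.
Defined.

Lemma unfreeE (F : pset) (u : F) : unfree F (smash_in one_plus u) = u.
Proof. by rewrite /= quot_liftE //; exact: unfree_compat. Qed.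

Lemma unfreeK (F : pset) s : smash_in one_plus (unfree F s) = s.
Proof.
have [c [u ->]] := psmashP s; have [->|->] := plus1P c; last by rewrite unfreeE.
rewrite [smash_in base u]smash_in_axes; last by left.
by rewrite (pmapP (unfree F)) smash_in_axes //; right.
Qed.

Lemma unfree_bij (F : pset) : bijective (unfree F).
Proof. by exists (smash_in one_plus); [exact: unfreeK|exact: unfreeE]. Qed.

Lemma unfree_natural (F G : pset) (t : pmap F G) s :
  unfree G (free_hom t 1 s) = t (unfree F s).
Proof. by rewrite -{1}(unfreeK s) [free_hom _ _ _]psmash_mapE unfreeE. Qed.

Definition wedge_case (X Y Z : pset) (f : pmap X Z) (g : pmap Y Z) : pmap (pwedge X Y) Z.
Proof.
exists (quot_lift (fun p => match p with inl x => f x | inr y => g y end)).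
by rewrite quot_liftE => [|_ _ [-> ->]]; rewrite !pmapP.
Defined.

Lemma wedge_casel (X Y Z : pset) (f : pmap X Z) (g : pmap Y Z) x :
  wedge_case f g (winl Y x) = f x.
Proof. by rewrite /= quot_liftE => [|_ _ [-> ->]]; rewrite ?pmapP. Qed.

Lemma wedge_caser (X Y Z : pset) (f : pmap X Z) (g : pmap Y Z) y :
  wedge_case f g (winr X y) = g y.
Proof. by rewrite /= quot_liftE => [|_ _ [-> ->]]; rewrite ?pmapP. Qed.

(** Recognition of a wedge: it suffices to split the level-one set of P into
    two pointed subsets, stable under the map, that meet in the base point
    only. *)
Lemma end_iso_wedge (P : EndC) (F G : pset) (finF : finite_set [set: F])
    (finG : finite_set [set: G]) (s : pmap F F) (t : pmap G G)
    (f : pmap F (P 1)) (g : pmap G (P 1)) :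
  injective f -> injective g ->
  (forall x y, f x = g y -> x = base) ->
  (forall z, (exists x, f x = z) \/ (exists y, g y = z)) ->
  (forall x, f (s x) = end_map P 1 (f x)) ->
  (forall y, g (t y) = end_map P 1 (g y)) ->
  end_iso (end_wedge (end_free finF s) (end_free finG t)) P.
Proof.
move=> fi gi disj cov fs gt.
pose f' := pcomp f (unfree F); pose g' := pcomp g (unfree G).
have fi' : injective f' by apply: inj_comp fi (bij_inj (unfree_bij F)).
have gi' : injective g' by apply: inj_comp gi (bij_inj (unfree_bij G)).
have disj' x y : f' x = g' y -> x = base /\ y = base.
  move=> e; have x0 : x = base.
    by apply: (bij_inj (unfree_bij F)); rewrite pmapP; exact: disj e.
  by split=> //; apply: gi'; rewrite -e x0 !pmapP.
have f'E x : f' x = f (unfree F x) by [].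
have g'E y : g' y = g (unfree G y) by [].
apply: (@end_iso_level1 (end_wedge (end_free finF s) (end_free finG t)) P (wedge_case f' g')); last first.
  move=> w; have [[x ->]|[y ->]] := pwedgeP w.
    by rewrite [end_map _ _ _]pwedge_mapl !wedge_casel !f'E -fs unfree_natural.
  by rewrite [end_map _ _ _]pwedge_mapr !wedge_caser !g'E -gt unfree_natural.
apply: inj_surj_bij.
  move=> w w'; have [[x ->]|[y ->]] := pwedgeP w; have [[x' ->]|[y' ->]] := pwedgeP w';
    rewrite ?wedge_casel ?wedge_caser.
  - by move=> /fi' ->.
  - by move=> /disj' [-> ->]; rewrite winr0.
  - by move=> /esym/disj' [-> ->]; rewrite winr0.
  - by move=> /gi' ->.
move=> z; have [[x <-]|[y <-]] := cov z.
  by exists (winl _ (smash_in one_plus x)); rewrite wedge_casel f'E unfreeE.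
by exists (winr _ (smash_in one_plus y)); rewrite wedge_caser g'E unfreeE.
Qed.

(** * Every endomorphism is built from cyclic permutations *)

Lemma finite_enum (T : Type) : finite_set [set: T] ->
  exists n (e : T -> 'I_n), bijective e.
Proof.
case=> n /card_set_bijP[f [fm fi fs]].
have fn x : (f x < n)%N by exact: (fm x I).
exists n, (fun x => Ordinal (fn x)); apply: inj_surj_bij.
  by move=> x y [] /fi; apply; exact: mem_setT.
by move=> i; have [x _ fx] := fs i (ltn_ord i); exists x; apply: val_inj.
Qed.

Lemma end_finite (P : EndC) : finite_set [set: P 1].
Proof. by have [] := classC_free_fin (end_class P). Qed.

Lemma end_enum (P : EndC) : exists d : {n & (P 1 -> 'I_n) * ('I_n -> P 1)}%type,
  cancel (tagged d).1 (tagged d).2.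
Proof.
have [n [e [e' ee' _]]] := finite_enum (end_finite P).
by exists (Tagged (fun n => ((P 1 -> 'I_n) * ('I_n -> P 1))%type) (e, e')).
Qed.

(** The level-one set of P as a finite type. The carrier is convertible to P
    1, so that points of P 1 can be used as elements of it and conversely. *)
Definition pts (P : EndC) : finType := can_type (svalP (cid (end_enum P))).

Lemma iter_inj (T : Type) (f : T -> T) n : injective f -> injective (iter n f).
Proof. by move=> fi; elim: n => [|n IH] x y //= /fi/IH. Qed.

Lemma iter_return (T : finType) (f : T -> T) x : injective f ->
  exists2 n, (0 < n)%N & iter n f x = x.
Proof.
move=> fi; exists (fingraph.order f x); first exact: order_gt0.
exact: iter_order.
Qed.

(** If the image had as many points, the map would be surjective on a finite
    set, hence injective. *)
Lemma card_image_lt (P : EndC) : ~ injective (end_map P 1) ->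
  (#|pts (end_image P)| < #|pts P|)%N.
Proof.
move=> ni; rewrite ltnNge; apply/negP => le; apply: ni.
pose j : pts (end_image P) -> pts P := fun y => sval (y : image_ob (end_map P) 1).
have ji : injective j by move=> [y hy] [z hz] /= e; apply: eq_exist.
have surj (y : pts P) : exists x : pts P, end_map P 1 x = y.
  have /codomP[[z [x xz]] ->] := inj_card_onto ji le y.
  by exists x.
pose s (y : pts P) : pts P := sval (cid (surj y)).
have sK : cancel s (end_map P 1 : pts P -> pts P) by move=> y; exact: svalP (cid (surj y)).
exact: (bij_inj (bij_can_bij (injF_bij (can_inj sK)) sK)).
Qed.

(** The orbit of a point x other than the base point under an injective map t
    splits off: it is a cycle of some length p + 1, and its complement, which
    contains the base point, is stable under t. *)
Section SplitCycle.
Variables (P : EndC) (x : P 1) (p : nat).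
Notation t := (end_map P 1).
Hypotheses (ti : injective t) (xn : x <> base) (px : iter p.+1 t x = x).
Hypothesis pmin : forall n, (n <= p)%N -> iter n t x = x -> n = 0%N.

Definition off_orbit (y : P 1) := forall n, y <> iter n t x.

Lemma iter_base n : iter n t base = base.
Proof. by elim: n => //= n ->; rewrite pmapP. Qed.

Lemma off_orbit_base : off_orbit base.
Proof. by move=> n e; apply: xn; apply: (iter_inj ti (n := n)); rewrite -e iter_base. Qed.

Definition complement : pset := @PSet {y | off_orbit y} (exist _ _ off_orbit_base).

(** Since t is injective, a point sent into the orbit already lies in it; the
    case of a point sent to x itself uses that x = t(t^p x). *)
Lemma off_orbit_map y : off_orbit y -> off_orbit (t y).
Proof.
move=> hy [|n] e; last by apply: (hy n); apply: ti.
by apply: (hy p); apply: ti; rewrite e -{1}px.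
Qed.

Definition complement_map : pmap complement complement.
Proof.
unshelve refine (@PMap complement complement
  (fun y => exist _ (t (sval y)) (off_orbit_map (svalP y))) _).
by apply: eq_exist; rewrite /= pmapP.
Defined.

Definition complement_incl : pmap complement (P 1) :=
  @PMap complement (P 1) (fun y => sval y) erefl.

Lemma complement_incl_inj : injective complement_incl.
Proof. by move=> [y hy] [z hz] /= e; apply: eq_exist. Qed.

Lemma complement_finite : finite_set [set: complement].
Proof. exact: finite_inj (end_finite P) complement_incl_inj. Qed.

(** The nonzero index i is sent to the (i - 1)-st iterate of x, so that the
    cyclic shift of the indices corresponds to t. *)
Definition orbit_map : pmap (plus p.+1) (P 1) :=
  @PMap (plus p.+1) (P 1) (fun i => if i == ord0 then base else iter i.-1 t x) erefl.

Lemma orbit_map_shift i : orbit_map (cyclic_shift p i) = t (orbit_map i).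
Proof.
rewrite /=; have [_|i0] := eqVneq i ord0; first by rewrite pmapP.
have ip : (0 < i)%N by rewrite lt0n; apply: contra i0 => /eqP i0; apply/eqP/val_inj.
have lt : (i %% p.+1 < p.+1)%N by rewrite ltn_mod.
have v : (inord (i %% p.+1).+1 : 'I_p.+2) = (i %% p.+1).+1 :> nat by rewrite inordK.
rewrite -val_eqE /= v /= -iterS prednK //.
have [e|ne] := eqVneq (i : nat) p.+1; first by rewrite e modnn px.
rewrite modn_small //; have := ltn_ord i.
by rewrite ltnS => le; rewrite ltn_neqAle ne le.
Qed.

Lemma iter_orbit_inj m n : (m <= n <= p)%N -> iter m t x = iter n t x -> m = n.
Proof.
move=> /andP[mn np]; rewrite -{1}(subnK mn) addnC iterD => e.
have h : iter (n - m) t x = x by apply: esym; apply: (iter_inj ti (n := m)).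
have := pmin (leq_trans (leq_subr _ _) np) h.
by move=> /eqP; rewrite subn_eq0 => nm; apply/eqP; rewrite eqn_leq mn.
Qed.

Lemma orbit_map_inj : injective orbit_map.
Proof.
have nb n : iter n t x <> base.
  by rewrite -(iter_base n) => /(iter_inj ti).
move=> i j /=; case: eqP => [->|i0]; case: eqP => [->|j0] //.
- by move=> /esym/nb.
- by move=> /nb.
have pos (k : 'I_p.+2) : k <> ord0 -> (0 < k)%N.
  by rewrite lt0n => k0; apply/eqP => e; apply: k0; apply: val_inj.
have bd (k : 'I_p.+2) : (k.-1 <= p)%N by have := ltn_ord k; case: (k : nat).
move=> e; apply: val_inj; rewrite /= -(prednK (pos _ i0)) -(prednK (pos _ j0)); congr S.
case: (leqP i.-1 j.-1) => [le|/ltnW le].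
  by apply: iter_orbit_inj e; rewrite le bd.
by apply/esym/(iter_orbit_inj _ (esym e)); rewrite le bd.
Qed.

Lemma orbit_map_onto n : exists i, orbit_map i = iter n t x.
Proof.
have lt : (n %% p.+1 < p.+1)%N by rewrite ltn_mod.
exists (inord (n %% p.+1).+1) => /=.
have v : (inord (n %% p.+1).+1 : 'I_p.+2) = (n %% p.+1).+1 :> nat by rewrite inordK.
rewrite -val_eqE /= v /= {2}(divn_eq n p.+1) addnC iterD.
suff -> q : iter (q * p.+1) t x = x by [].
by elim: q => // q IH; rewrite mulSn iterD IH px.
Qed.

Lemma split_cycle :
  end_iso (end_wedge (end_cycle p) (end_free complement_finite complement_map)) P.
Proof.
apply: (@end_iso_wedge P _ _ _ _ _ _ orbit_map complement_incl).
- exact: orbit_map_inj.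
- exact: complement_incl_inj.
- move=> i [y hy] /=; case: eqP => // i0 e.
  by have := hy i.-1; rewrite e.
- move=> z; have [[n ->]|nz] := pselect (exists n, z = iter n t x).
    by left; exact: orbit_map_onto.
  by right; unshelve eexists (exist _ z _) => // n e; apply: nz; exists n.
- exact: orbit_map_shift.
- by move=> y.
Qed.

Lemma card_complement :
  (#|pts (end_free complement_finite complement_map)| < #|pts P|)%N.
Proof.
pose j : pts (end_free complement_finite complement_map) -> pts P :=
  fun s => complement_incl (unfree complement s).
have ji : injective j.
  by apply: inj_comp complement_incl_inj (bij_inj (unfree_bij complement)).
rewrite ltnNge; apply/negP => le; have /codomP[s e] := inj_card_onto ji le x.
by have := svalP (unfree complement s) 0%N; apply; rewrite -[LHS]/(j s) -e.
Qed.

End SplitCycle.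

(** By induction on the number of points. A map that is not injective is
    replaced by its restriction to its image, which has fewer points; under
    an injective map the orbit of a point other than the base point is a
    cycle that splits off, and the complement has fewer points. *)
Lemma EndC_ind (Pr : EndC -> Prop) :
  (forall P Q, end_iso P Q -> Pr P -> Pr Q) ->
  (forall P, Pr (end_image P) -> Pr P) ->
  (forall P Q, Pr P -> Pr Q -> Pr (end_wedge P Q)) ->
  (forall P : EndC, (forall x : P 1, x = base) -> Pr P) ->
  (forall n, Pr (end_cycle n)) ->
  forall P, Pr P.
Proof.
move=> Hiso Him Hw H0 Hc P; have [N] := ubnP #|pts P|.
elim: N P => // N IH P leN.
have [ti|nti] := pselect (injective (end_map P 1)); last first.
  by apply: Him; apply: IH; apply: leq_trans (card_image_lt nti) _.
have [h|] := pselect (forall x : P 1, x = base); first exact: H0.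
move=> /existsNP[x xn].
(* The length p.+1 of the cycle is the least positive exponent that fixes x. *)
have ex : exists n, (0 < n)%N && `[< iter n (end_map P 1) x = x >].
  have [n n0 e] := @iter_return (pts P) (end_map P 1) x ti.
  by exists n; rewrite n0; apply/asboolP.
case: (ex_minnP ex) => -[//|p] /andP[_ /asboolP px] pmin.
have {}pmin n : (n <= p)%N -> iter n (end_map P 1) x = x -> n = 0%N.
  case: n => // n np e; have h : (p < n.+1)%N by apply: pmin; apply/asboolP.
  by have := leq_ltn_trans np h; rewrite ltnn.
apply: (Hiso _ _ (split_cycle ti xn px pmin)); apply: Hw; first exact: Hc.
by apply: IH; apply: leq_trans (card_complement ti xn px) _.
Qed.

(** * Sums over the periodic points *)

(** The exponents n with f^n x = x are the multiples of the least positive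
    one, or only 0 if there is no positive one. *)
Lemma period_ex (T : Type) (f : T -> T) x :
  exists p, forall n, iter n f x = x <-> (p %| n)%N.
Proof.
have [h|h] := pselect (exists n, (0 < n)%N && `[< iter n f x = x >]); last first.
  exists 0%N => n; rewrite dvd0n; split=> [e|/eqP -> //].
  by case: n e => // n e; case: h; exists n.+1; apply/asboolP.
case: (ex_minnP h) => p /andP[p0 /asboolP px] pmin; exists p => n.
have mulp q : iter (q * p) f x = x by elim: q => // q IH; rewrite mulSn iterD IH px.
split=> [|/dvdnP[q ->] //]; rewrite {1}(divn_eq n p) addnC iterD mulp /dvdn => e.
apply: contraT; rewrite -lt0n => r0.
have : (p <= n %% p)%N by apply: pmin; rewrite r0; apply/asboolP.
by rewrite leqNgt ltn_mod p0.
Qed.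

(** The period of x if x is periodic, and 0 if it is not. With this
    convention the period generates the set of exponents n such that f^n x =
    x in all cases, so that it is characterised by [period_eq]. *)
Definition period (T : Type) (f : T -> T) x : nat := sval (cid (period_ex f x)).

Lemma periodP (T : Type) (f : T -> T) x n : iter n f x = x <-> (period f x %| n)%N.
Proof. exact: (svalP (cid (period_ex f x))). Qed.

Lemma period_eq (T : Type) (f : T -> T) x p :
  (forall n, iter n f x = x <-> (p %| n)%N) -> period f x = p.
Proof.
move=> h; apply/eqP; rewrite eqn_dvd.
by apply/andP; split; [apply/periodP/h|apply/h/periodP].
Qed.

Lemma period_map (T S : Type) (f : T -> T) (g : S -> S) (j : T -> S) x :
  injective j -> (forall y, j (f y) = g (j y)) -> period g (j x) = period f x.
Proof.
move=> ji jf; apply: period_eq => n; rewrite -periodP.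
have -> : iter n g (j x) = j (iter n f x) by elim: n => //= n ->; rewrite jf.
by split=> [/ji|->].
Qed.

(** The map j only has to reach the points at which G is not zero. *)
Lemma sum_reindex (A : zmodType) (S S' : finType) (j : S -> S') (a : pred S) (b : pred S')
    (G : S' -> A) :
  {in a &, injective j} -> (forall x, a x -> b (j x)) ->
  (forall y, b y -> G y != 0 -> exists2 x, a x & j x = y) ->
  \sum_(y | b y) G y = \sum_(x | a x) G (j x).
Proof.
move=> ji ab cov; rewrite -[RHS](big_imset (A := a) G) //=.
rewrite (bigID (mem (j @: a))) /= [X in _ + X]big1 ?addr0 => [|y /andP[by_ yn]]; last first.
  apply/eqP; apply: contraNT yn => /(cov _ by_)[x ax <-].
  by apply/imsetP; exists x.
apply: eq_bigl => y; case: imsetP => [[x ax ->]|_]; last by rewrite andbF.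
by rewrite andbT; exact: ab.
Qed.

Section PeriodSum.
Variables (A : zmodType) (F : nat -> A).
Hypothesis F0 : F 0%N = 0.

(** The value F 0 is the weight given to the points that are not periodic. *)
Definition psum (P : EndC) : A :=
  \sum_(x : pts P | x != base) F (period (end_map P 1) x).

(** Covering the periodic points suffices because F 0 = 0. This handles
    isomorphisms and inclusions of images together. *)
Lemma psum_transfer (P Q : EndC) (j : pmap (P 1) (Q 1)) :
  injective j -> (forall x, j (end_map P 1 x) = end_map Q 1 (j x)) ->
  (forall y n, (0 < n)%N -> iter n (end_map Q 1) y = y -> exists x, j x = y) ->
  psum Q = psum P.
Proof.
move=> ji jT cov; rewrite /psum.
rewrite (@sum_reindex _ (pts P) (pts Q) j (fun x => x != base)).
- by apply: eq_bigr => x _; rewrite (period_map x ji jT).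
- by move=> x y _ _ /ji.
- move=> x; apply: contra => /eqP e; apply/eqP; apply: ji; rewrite e pmapP //.
- move=> y yn Fn.
  have p0 : (0 < period (end_map Q 1) y)%N by rewrite lt0n; apply: contraNneq Fn => ->; rewrite F0.
  have [x xy] := cov y _ p0 (proj2 (periodP _ _ _) (dvdnn _)).
  by exists x => //; apply: contraNneq yn => x0; rewrite -xy x0 pmapP.
Qed.

(** Periodic points belong to the image. *)
Lemma iter_image (T : Type) (f : T -> T) n y : (0 < n)%N -> iter n f y = y ->
  exists x, f x = y.
Proof. by case: n => // n _ e; exists (iter n f y). Qed.

Lemma psum_wedge (P Q : EndC) : psum (end_wedge P Q) = psum P + psum Q.
Proof.
pose j (s : pts P + pts Q) : pts (end_wedge P Q) :=
  match s with inl x => winl (Q 1) x | inr y => winr (P 1) y end.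
pose a (s : pts P + pts Q) := match s with inl x => x != base | inr y => y != base end.
rewrite /psum (@sum_reindex _ _ _ j a); last 3 first.
- move=> [x|y] [x'|y']; rewrite !unfold_in /= => h h'.
  + by move=> /winl_inj ->.
  + by move=> /winlr[e _]; rewrite e eqxx in h.
  + by move=> /esym/winlr[e _]; rewrite e eqxx in h'.
  + by move=> /winr_inj ->.
- move=> [x|y] /=; apply: contraNneq.
    by move=> /winl_inj ->.
  by move=> e; apply/eqP; apply: (@winr_inj (P 1)); rewrite winr0.
- move=> w wn _; have [[x e]|[y e]] := pwedgeP w.
    exists (inl x) => //=; apply: contraNneq wn => x0; rewrite e x0.
    by [].
  exists (inr y) => //=; apply: contraNneq wn => y0; rewrite e y0.
  by rewrite winr0.
rewrite big_sumType /=; congr (_ + _); apply: eq_bigr => x _; congr F.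
  by apply: period_map => [y z /winl_inj //|y]; rewrite [RHS]pwedge_mapl.
by apply: period_map => [y z /winr_inj //|y]; rewrite [RHS]pwedge_mapr.
Qed.

Lemma psum_trivial (P : EndC) : (forall x : P 1, x = base) -> psum P = 0.
Proof. by move=> h; rewrite /psum big1 // => x; rewrite [x]h eqxx. Qed.

Lemma iter_cyclic_shift n k (i : 'I_n.+1) :
  iter k (cyclic_shift n) (lift ord0 i) = lift ord0 (inord ((i + k) %% n.+1)).
Proof.
elim: k => [|k IH]; first by rewrite addn0 modn_small // inord_val.
rewrite iterS IH /=; apply: val_inj.
have lt m : (m %% n.+1 < n.+1)%N by rewrite ltn_mod.
have lt' m : ((m %% n.+1).+1 < n.+2)%N := lt m.
rewrite /= /bump /= !add1n (@inordK n.+1 _ (lt' _)) !inordK //; congr S.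
by rewrite -addn1 modnDml addn1 addnS.
Qed.

(** The base point is index 0, so the points moved by the shift are the
    indices lift ord0 i. *)
Lemma period_cyclic_shift n (i : 'I_n.+1) :
  period (cyclic_shift n) (lift ord0 i) = n.+1.
Proof.
apply: period_eq => k; rewrite iter_cyclic_shift; split=> [/lift_inj/(congr1 val) /=|].
  rewrite inordK ?ltn_mod // -{2}(modn_small (ltn_ord i)) -{2}[nat_of_ord i]addn0 => /eqP.
  by rewrite eqn_modDl mod0n.
move=> kn; congr lift; apply: val_inj; rewrite /= inordK ?ltn_mod //.
by rewrite -modnDmr (eqP kn) addn0 modn_small.
Qed.

Lemma psum_cycle n : psum (end_cycle n) = F n.+1 *+ n.+1.
Proof.
pose j (i : 'I_n.+1) : pts (end_cycle n) :=
  smash_in one_plus (lift ord0 i : plus n.+1).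
have uj i : unfree (plus n.+1) (j i) = lift ord0 i by exact: unfreeE.
rewrite /psum (@sum_reindex _ _ _ j predT); last 3 first.
- by move=> x y _ _ e; apply: (@lift_inj _ ord0); rewrite -!uj e.
- move=> i _; apply/eqP => e; have := uj i; rewrite e pmapP => /eqP.
  by rewrite (negPf (neq_lift _ _)).
- move=> y yn _; case: (unliftP ord0 (unfree (plus n.+1) y)) => [i e|e].
    by exists i => //; rewrite /j -e unfreeK.
  case/eqP: yn; apply: (bij_inj (unfree_bij _)); rewrite e pmapP //.
transitivity (\sum_(i < n.+1) F n.+1); last by rewrite sumr_const card_ord.
apply: eq_bigr => i _; congr F.
rewrite -(@period_map _ _ _ (cyclic_shift n) (unfree (plus n.+1))).
- by rewrite uj period_cyclic_shift.
- exact: bij_inj (unfree_bij _).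
- by move=> s; exact: unfree_natural.
Qed.

End PeriodSum.

(** * Periods in a smash product *)

Lemma smod_map_one (E : Smod) (x : E 1) : smod_map E (sel one_plus) x = x.
Proof.
rewrite -[RHS](smod_id x); congr (smod_map E _ x); apply: pmap_eq => i /=.
by have [->|->] := plus1P i.
Qed.

Section SmashLevelOne.
Variables P Q : EndC.
Notation gen := (@unit_gen P Q).

Lemma unit_gen_axes u v : u = base \/ v = base -> gen u v = base.
Proof. exact: day_in_base. Qed.

(** At level one the Day smash product is the smash product of the level-one
    sets: [day_coord] is a left inverse of the map sending (u, v) to its
    generator, up to the collapsed axes. *)
Lemma unit_gen_eq u v u' v' : gen u v = gen u' v' ->
  (u = u' /\ v = v') \/ (on_axes (u, v) /\ on_axes (u', v')).
Proof.
have ffP := classC_free_fin (end_class P); have ffQ := classC_free_fin (end_class Q).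
move=> e; apply: smash_in_inj; move: e => /(congr1 (day_coord ffP ffQ (k := 1))).
rewrite -(smod_map_one (gen u v)) -(smod_map_one (gen u' v')) !day_coordE.
by case/smash_in_inj => [[_ //]|[[//|/= ->] [//|/= ->]]].
Qed.

Lemma unit_gen_base u v : gen u v = base -> u = base \/ v = base.
Proof.
rewrite -(@unit_gen_axes base base); last by left.
by case/unit_gen_eq => [[-> _]|[h _]] //; left.
Qed.

Lemma unit_genP (z : smash_Smod P Q 1) : exists u v, z = gen u v.
Proof.
have ffP := classC_free_fin (end_class P); have ffQ := classC_free_fin (end_class Q).
have [c [u [v ->]]] := day_spanned ffP ffQ z; have [->|->] := plus1P c.
  by exists base, base; rewrite sel0 smod_map0 unit_gen_axes //; left.
by exists u, v; rewrite smod_map_one.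
Qed.

Lemma end_smash_gen u v : end_map (end_smash P Q) 1 (gen u v)
  = gen (end_map P 1 u) (end_map Q 1 v).
Proof. exact: smash_hom_obE. Qed.

(** The n-th iterate fixes u /\ v, when this is not the base point, if and
    only if it fixes u and v; that is, if and only if n is a common multiple
    of their periods. This holds also for points that are not periodic, since
    the least common multiple of 0 and any number is 0. *)
Lemma period_smash u v : gen u v <> base ->
  period (end_map (end_smash P Q) 1) (gen u v)
  = lcmn (period (end_map P 1) u) (period (end_map Q 1) v).
Proof.
move=> nb; apply: period_eq => n.
have -> : iter n (end_map (end_smash P Q) 1) (gen u v)
    = gen (iter n (end_map P 1) u) (iter n (end_map Q 1) v).
  by elim: n => // n IH; rewrite !iterS IH end_smash_gen.
rewrite dvdn_lcm; split=> [|/andP[/periodP -> /periodP ->] //].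
case/unit_gen_eq => [[/periodP -> /periodP ->] //|[_ /unit_gen_axes]].
by move=> e; case: nb.
Qed.

Lemma psum_smash (A : zmodType) (F : nat -> A) :
  psum F (end_smash P Q) = \sum_(u : pts P | u != base) \sum_(v : pts Q | v != base)
    F (lcmn (period (end_map P 1) u) (period (end_map Q 1) v)).
Proof.
pose j (s : pts P * pts Q) : pts (end_smash P Q) := gen s.1 s.2.
have nb u v : u <> base -> v <> base -> gen u v <> base.
  by move=> un vn /unit_gen_base [].
rewrite pair_big_dep /psum (@sum_reindex _ _ _ j (fun s => (s.1 != base) && (s.2 != base))).
- by apply: eq_bigr => -[u v] /= /andP[/eqP un /eqP vn]; rewrite period_smash //; exact: nb.
- move=> [u v] [u' v'] /andP[/= /eqP un /eqP vn] _ e.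
  by have [[-> ->]|[[]]] := @unit_gen_eq u v u' v' e.
- by move=> [u v] /andP[/= /eqP un /eqP vn]; apply/eqP; exact: nb.
- move=> z zn _; have [u [v e]] := unit_genP z; exists (u, v) => //=.
  by apply/andP; split; apply: contraNneq zn => h; rewrite e unit_gen_axes //; [left|right].
Qed.

End SmashLevelOne.

(** * The universal additive invariant *)

Lemma inv_torsion_sum0 : inv_torsion_sum 0 = 0.
Proof. by apply: inv_val_inj; rewrite /= /torsion_sum big_ord0. Qed.

(** These M make all the quotients M / p in [weighted_torsion] exact. *)
Definition period_multiple (P : EndC) M :=
  forall x : P 1, (0 < period (end_map P 1) x)%N -> (period (end_map P 1) x %| M)%N.

Lemma period_multiple_ex (P : EndC) : exists2 M, (0 < M)%N & period_multiple P M.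
Proof.
exists (\prod_(x : pts P) maxn 1 (period (end_map P 1) x))%N.
  by apply: prodn_gt0 => x; rewrite leq_max.
move=> x x0; rewrite (bigD1 (x : pts P)) //= (maxn_idPr x0).
exact: dvdn_mulr.
Qed.

(** The contribution of a point of period p to M times the universal
    invariant: in total a cycle of length p contributes p (M / p) = M times
    N_p. A point that is not periodic has p = 0 and contributes N_0 = 0. *)
Definition weighted_torsion M p : invariant_ring QZ := inv_torsion_sum p *+ (M %/ p).

Lemma weighted_torsion0 M : weighted_torsion M 0 = 0.
Proof. by rewrite /weighted_torsion inv_torsion_sum0 mul0rn. Qed.

Lemma weighted_torsion_mulr P M N : period_multiple P M ->
  psum (weighted_torsion (M * N)) P = psum (weighted_torsion M) P *+ N.
Proof.
move=> h; rewrite /psum -sumrMnl; apply: eq_bigr => x _; rewrite /weighted_torsion.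
have [->|/h pM] := posnP (period (end_map P 1) x); first by rewrite inv_torsion_sum0 !mul0rn.
by rewrite -mulrnA divn_mulAC.
Qed.

(** For m, n > 0 this is [torsion_sum_mul], divided by the least common
    multiple, which is legitimate in a torsion-free group. *)
Lemma weighted_torsion_smash M N p q : ((0 < p)%N -> (p %| M)%N) -> ((0 < q)%N -> (q %| N)%N) ->
  weighted_torsion (M * N) (lcmn p q) = weighted_torsion M p * weighted_torsion N q.
Proof.
have [-> _ _|p0 /(_ isT) pM] := posnP p; first by rewrite lcm0n !weighted_torsion0 mul0r.
have [-> _|q0 /(_ isT) qN] := posnP q; first by rewrite lcmn0 !weighted_torsion0 mulr0.
have L0 : (0 < lcmn p q)%N by rewrite lcmn_gt0 p0.
apply: (mulrn_invariant_inj L0); rewrite /weighted_torsion -mulrnA divnK; last first.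
  by rewrite dvdn_lcm (dvdn_mulr _ pM) (dvdn_mull _ qN).
rewrite mulrnAl mulrnAr [RHS]mulrnAC (mulrnAC (inv_torsion_sum p * inv_torsion_sum q)).
rewrite inv_torsion_sum_mul -!mulrnA.
by congr (_ *+ _); rewrite [(N %/ q * _)%N]mulnC mulnACA ![(_ * (_ %/ _))%N]mulnC !divnK.
Qed.

(** The element z is the sum of N_p over the cycles of P other than the base
    point, where p is the length of the cycle; multiplication by M allows a
    summation over points instead of cycles. *)
Definition is_witt (P : EndC) (z : invariant_ring QZ) :=
  forall M, (0 < M)%N -> period_multiple P M -> z *+ M = psum (weighted_torsion M) P.

Lemma is_witt_unique P z z' : is_witt P z -> is_witt P z' -> z = z'.
Proof.
have [M M0 Mm] := period_multiple_ex P.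
move=> /(_ M M0 Mm) e /(_ M M0 Mm) e'.
by apply: (mulrn_invariant_inj M0); rewrite e e'.
Qed.

(** One M is enough, since the condition for M follows from the one for M N
    and implies it. *)
Lemma is_witt_one (P : EndC) M z : (0 < M)%N -> period_multiple P M ->
  z *+ M = psum (weighted_torsion M) P -> is_witt P z.
Proof.
move=> M0 Mm e N N0 Nm; apply: (mulrn_invariant_inj M0).
by rewrite -mulrnA mulnC mulrnA e -!weighted_torsion_mulr // mulnC.
Qed.

(** The periodic points and their periods are the same on both sides. *)
Lemma is_witt_transfer (P Q : EndC) (j : pmap (P 1) (Q 1)) z :
  injective j -> (forall x, j (end_map P 1 x) = end_map Q 1 (j x)) ->
  (forall y n, (0 < n)%N -> iter n (end_map Q 1) y = y -> exists x, j x = y) ->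
  is_witt P z <-> is_witt Q z.
Proof.
move=> ji jT cov.
have mult M : period_multiple P M <-> period_multiple Q M.
  split=> h x x0.
    have [y yx] := cov x _ x0 (proj2 (periodP _ _ _) (dvdnn _)).
    by move: x0; rewrite -yx (period_map y ji jT) => /h.
  by have := h (j x); rewrite (period_map x ji jT); exact.
split=> h M M0 /mult Mm; rewrite (h M M0 Mm).
  by symmetry; exact: (psum_transfer (weighted_torsion0 M) ji jT cov).
exact: (psum_transfer (weighted_torsion0 M) ji jT cov).
Qed.

Lemma is_witt_iso P Q z : end_iso P Q -> is_witt P z <-> is_witt Q z.
Proof.
case=> f [g [[fK gK] fT]]; apply: (@is_witt_transfer P Q (f 1)) => //.
  exact: can_inj (fK 1).
by move=> y n _ _; exists (g 1 y); exact: gK.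
Qed.

Definition image_incl (P : EndC) : pmap (end_image P 1) (P 1) :=
  @PMap (image_ob (end_map P) 1) (P 1) (fun y => sval y) erefl.

Lemma is_witt_image P z : is_witt (end_image P) z <-> is_witt P z.
Proof.
apply: (@is_witt_transfer _ _ (image_incl P)) => //.
  by move=> [y hy] [z' hz] /= e; apply: eq_exist.
by move=> y n n0 /(iter_image n0) hy; exists (exist _ y hy).
Qed.

Lemma is_witt_wedge P Q z z' : is_witt P z -> is_witt Q z' -> is_witt (end_wedge P Q) (z + z').
Proof.
move=> hz hz' M M0 Mm; rewrite mulrnDl hz // ?hz' // ?psum_wedge //.
  move=> y; have := Mm (winr (P 1) y).
  rewrite (@period_map _ _ (end_map Q 1) _ (@winr (P 1) (Q 1))) //.
    exact: winr_inj.
  by move=> x; rewrite [RHS]pwedge_mapr.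
move=> y; have := Mm (winl (Q 1) y).
rewrite (@period_map _ _ (end_map P 1) _ (@winl (P 1) (Q 1))) //.
  exact: winl_inj.
by move=> x; rewrite [RHS]pwedge_mapl.
Qed.

Lemma is_witt_cycle n : is_witt (end_cycle n) (inv_torsion_sum n.+1).
Proof.
have h M : is_true (n.+1 %| M)%N -> psum (weighted_torsion M) (end_cycle n) = inv_torsion_sum n.+1 *+ M.
  by move=> nM; rewrite psum_cycle ?weighted_torsion0 // /weighted_torsion -mulrnA divnK.
move=> M M0 Mm; rewrite h //.
pose x : end_cycle n 1 := smash_in one_plus (lift ord0 ord0 : plus n.+1).
have px : period (end_map (end_cycle n) 1) x = n.+1.
  rewrite -(@period_map _ _ _ (cyclic_shift n) (unfree (plus n.+1))).
  - by rewrite unfreeE period_cyclic_shift.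
  - exact: bij_inj (unfree_bij _).
  - by move=> s; exact: unfree_natural.
by have := Mm x; rewrite px; exact.
Qed.

(** The defining condition is compatible with isomorphisms, images and
    wedges, and holds for a cycle of length m with z = N_m, so [EndC_ind]
    applies. *)
Lemma is_witt_ex P : exists z, is_witt P z.
Proof.
elim/EndC_ind: P => [P Q PQ [z hz]|P [z hz]|P Q [z hz] [z' hz']|P h|n].
- by exists z; apply/(is_witt_iso _ PQ).
- by exists z; apply/is_witt_image.
- by exists (z + z'); exact: is_witt_wedge.
- by exists 0 => M _ _; rewrite mul0rn psum_trivial.
- by exists (inv_torsion_sum n.+1); exact: is_witt_cycle.
Qed.

Definition witt P : invariant_ring QZ := sval (cid (is_witt_ex P)).

Lemma wittP P : is_witt P (witt P).
Proof. exact: svalP (cid (is_witt_ex P)). Qed.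

Lemma witt_eq P z : is_witt P z -> witt P = z.
Proof. by move=> h; exact: is_witt_unique (@wittP P) h. Qed.

Lemma witt_additive : additive_invariant witt.
Proof.
split=> [P Q PQ|P|P Q].
- by apply: witt_eq; apply/(is_witt_iso _ PQ)/wittP.
- by apply: witt_eq; apply/is_witt_image/wittP.
- by apply: witt_eq; apply: is_witt_wedge; exact: wittP.
Qed.

Lemma witt_cycle n : witt (end_cycle n) = inv_torsion_sum n.+1.
Proof. exact/witt_eq/is_witt_cycle. Qed.

(** With M for P and N for Q, the sum over the points of the smash product,
    taken with M N, factors as the product of the sums over P and Q. *)
Lemma witt_multiplicative P Q : witt (end_smash P Q) = witt P * witt Q.
Proof.
have [M M0 Mm] := period_multiple_ex P; have [N N0 Nm] := period_multiple_ex Q.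
have e : psum (weighted_torsion (M * N)) (end_smash P Q)
    = psum (weighted_torsion M) P * psum (weighted_torsion N) Q.
  rewrite psum_smash /psum mulr_suml; apply: eq_bigr => u _; rewrite mulr_sumr.
  by apply: eq_bigr => v _; apply: weighted_torsion_smash; [exact: Mm|exact: Nm].
apply: witt_eq; apply: (@is_witt_one _ (M * N)); first by rewrite muln_gt0 M0.
  move=> z; have [u [v ->]] := unit_genP z.
  have [->|nb] := pselect (unit_gen u v = base).
    rewrite (@period_eq _ _ _ 1) // => n; rewrite dvd1n; split=> // _.
    by elim: n => // n IH; rewrite iterS IH; exact: (pmapP (end_map (end_smash P Q) 1)).
  rewrite period_smash // lcmn_gt0 dvdn_lcm => /andP[/Mm pM /Nm qN].
  by rewrite (dvdn_mulr _ pM) (dvdn_mull _ qN).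
by rewrite e -wittP // -wittP // mulrnAl mulrnAr -mulrnA mulnC.
Qed.

(** * Universality and uniqueness *)

Lemma end_iso_trivial (P Q : EndC) :
  (forall x : P 1, x = base) -> (forall y : Q 1, y = base) -> end_iso P Q.
Proof.
move=> hP hQ; apply: (@end_iso_level1 P Q (pzero (P 1) (Q 1))).
  by exists (pzero (Q 1) (P 1)) => x; rewrite ?(hP x) ?(hQ x).
by move=> x; rewrite [RHS]hQ.
Qed.

(** A trivial P is isomorphic to its wedge with itself. *)
Lemma additive_invariant_trivial (A : zmodType) (psi : EndC -> A) (P : EndC) :
  additive_invariant psi -> (forall x : P 1, x = base) -> psi P = 0.
Proof.
case=> iso _ wedge hP; apply: (addrI (psi P)); rewrite addr0 -wedge; apply: iso.
apply: end_iso_trivial => // w; have [[x ->]|[x ->]] := pwedgeP w; rewrite (hP x) //.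
by rewrite winr0.
Qed.

Lemma additive_invariant_eq (A : zmodType) (psi psi' : EndC -> A) :
  additive_invariant psi -> additive_invariant psi' ->
  (forall n, psi (end_cycle n) = psi' (end_cycle n)) -> psi =1 psi'.
Proof.
move=> ai ai' e; case: (ai) (ai') => iso im wedge [iso' im' wedge'].
elim/EndC_ind => [P Q PQ|P|P Q|P hP|//].
- by rewrite (iso P Q) // (iso' P Q).
- by rewrite (im P) (im' P).
- by rewrite wedge wedge' => -> ->.
- by rewrite !additive_invariant_trivial.
Qed.

Lemma additive_invariant_comp (A B : zmodType) (psi : EndC -> A) (h : {additive A -> B}) :
  additive_invariant psi -> additive_invariant (h \o psi).
Proof.
case=> iso im wedge; split=> [P Q /iso /= ->//|P|P Q] /=; first by rewrite -im.
by rewrite wedge raddfD.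
Qed.

(** Prescribe the additive map on the basis N_m by the values of the given
    invariant on cycles; the two invariants then agree on cycles, hence
    everywhere. *)
Lemma witt_universal_invariant : universal_invariant witt.
Proof.
split=> [|A psi ai]; first exact: witt_additive.
have [h hE] := inv_torsion_sum_extend (fun n => psi (end_cycle n)).
have psiE : psi =1 h \o witt.
  apply: additive_invariant_eq => //; first exact: additive_invariant_comp witt_additive.
  by move=> n; rewrite /= witt_cycle hE.
exists h; split=> // h' psiE'; apply: inv_torsion_sum_additive_eq => n.
by rewrite -witt_cycle -[LHS]psiE' -[RHS]psiE.
Qed.

Definition concrete_Witt_ring : global_Witt_ring :=
  GlobalWittRing witt_universal_invariant witt_multiplicative.

(** Uniqueness in the universal property: the values of a universal invariant
    generate its target, in the sense needed to compare additive maps. *)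
Lemma universal_additive_eq (W A : zmodType) (chi : EndC -> W) (h h' : {additive W -> A}) :
  universal_invariant chi -> (forall P, h (chi P) = h' (chi P)) -> h =1 h'.
Proof.
move=> [ai univ] e; have [k [_ ku]] := univ A _ (additive_invariant_comp h ai).
by move=> x; rewrite (ku h) // (ku h').
Qed.

Section Uniqueness.
Variable W : global_Witt_ring.
Notation cls := (witt_class W).

(** Two universal invariants determine mutually inverse additive maps between
    their targets. *)
Lemma witt_comparison : exists f : {additive W -> invariant_ring QZ},
  bijective f /\ forall P, f (cls P) = witt P.
Proof.
have [aiW univW] := witt_universal W; have [aiI univI] := witt_universal_invariant.
have [f [fE _]] := univW _ _ aiI; have [g [gE _]] := univI _ _ aiW.
have fE' P : f (cls P) = witt P by rewrite fE.
have gE' P : g (witt P) = cls P by rewrite gE.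
exists f; split=> //.
pose gf : {additive W -> W} := g \o f.
pose fg : {additive invariant_ring QZ -> invariant_ring QZ} := f \o g.
exists g => x.
  apply: (@universal_additive_eq _ _ cls gf idfun) (witt_universal W) _ x => P.
  by rewrite /= fE' gE'.
apply: (@universal_additive_eq _ _ witt fg idfun) witt_universal_invariant _ x => P.
by rewrite /= gE' fE'.
Qed.

Lemma witt_ring_additive_eq (A : zmodType) (h h' : W -> A) :
  zmod_morphism h -> zmod_morphism h' ->
  (forall P, h (cls P) = h' (cls P)) -> h =1 h'.
Proof.
move=> hB hB' e.
pose ha : {additive W -> A} := HB.pack h (GRing.isZmodMorphism.Build W A h hB).
pose ha' : {additive W -> A} := HB.pack h' (GRing.isZmodMorphism.Build W A h' hB').
exact: (@universal_additive_eq _ _ cls ha ha' (witt_universal W)).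
Qed.

(** By additivity in each variable separately it is enough to check products
    of generators. *)
Lemma witt_ring_mul (B : comPzRingType) (f : {additive W -> B}) :
  (forall P Q, f (cls P * cls Q) = f (cls P) * f (cls Q)) -> {morph f : x y / x * y}.
Proof.
move=> fM x y; move: x.
apply: witt_ring_additive_eq => [x x'|x x'|P]; rewrite ?mulrBl ?raddfB ?mulrBl //.
move: y; apply: witt_ring_additive_eq => [x x'|x x'|Q]; rewrite ?mulrBr ?raddfB ?mulrBr //.
Qed.

Lemma witt_ring_rmorphism : exists f : {rmorphism W -> invariant_ring QZ},
  bijective f /\ forall P, f (cls P) = witt P.
Proof.
have [f [fb fE]] := witt_comparison.
have fM : {morph f : x y / x * y}.
  apply: witt_ring_mul => P Q.
  by rewrite -witt_smash !fE witt_multiplicative.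
have f1 : f 1 = 1.
  (* f is onto, so f 1 is neutral because f 1 * f y = f (1 * y) for all y. *)
  by have [g _ gK] := fb; rewrite -[f 1]mulr1 -[X in _ * X]gK -fM mul1r gK.
pose F : {rmorphism W -> invariant_ring QZ} :=
  HB.pack (f : W -> invariant_ring QZ)
    (GRing.isZmodMorphism.Build W (invariant_ring QZ) f (raddfB f))
    (GRing.isMonoidMorphism.Build W (invariant_ring QZ) f (f1, fM)).
by exists F.
Qed.

Lemma canonicalP (f : {rmorphism W -> invariant_ring QZ}) :
  canonical f <-> forall n, f (cls (end_cycle n)) = inv_torsion_sum n.+1.
Proof.
by split=> h n; [apply: inv_val_inj; rewrite h|rewrite h].
Qed.

Lemma canonical_unique (f g : {rmorphism W -> invariant_ring QZ}) :
  canonical f -> canonical g -> g =1 f.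
Proof.
move=> /canonicalP cf /canonicalP cg.
apply: (universal_additive_eq (witt_universal W)).
have [aiW _] := witt_universal W.
apply: additive_invariant_eq; [exact: additive_invariant_comp aiW..|].
by move=> n; rewrite /= cf cg.
Qed.

End Uniqueness.

Theorem theorem1p1 :
  inhabited global_Witt_ring /\
  (forall W : global_Witt_ring,
     exists f : {rmorphism W -> invariant_ring QZ},
       [/\ bijective f,
           canonical f &
           forall g : {rmorphism W -> invariant_ring QZ}, canonical g -> g =1 f]) /\
  (exists phi : zaut QZ -> Zhat,
     [/\ injective phi,
         forall a : Zhat, Zhat_unit a <-> exists u, phi u = a,
         forall u v : zaut QZ, phi (zaut_comp u v) = Zhat_mul (phi u) (phi v) &
         forall (u : zaut QZ) (n : nat), u (qz (1 / n.+1%:R)) = qz ((phi u n)%:R / n.+1%:R)]).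
Proof.
split; first by constructor; exact: concrete_Witt_ring.
split=> [W|].
  have [f [fb fE]] := witt_ring_rmorphism W.
  have cf : canonical f by apply/canonicalP => n; rewrite fE witt_cycle.
  by exists f; split=> // g; exact: canonical_unique.
exists zaut_zhat; split; [exact: zaut_zhat_inj|exact: Zhat_unitP|exact: zaut_zhat_comp|].
exact: zaut_valE.
Qed.
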